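(* Let $(R,\mathfrak{m})$ be an LC-finite regular local ring with $\dim R\leq 6$, and let $I\supset J$ be ideals of $R$. Suppose that each of $I$ and $J$ is generated by a part of a regular system of parameters of $R$. Then $\operatorname{Ass} H_I^i(J)$ is finite for any $i\geq 0$.
   Context: All rings are commutative with identity. $H_I^i(M)$ denotes the $i$-th local cohomology module of $M$ with respect to $I$, and $\operatorname{Ass} M$ is the set of associated primes of $M$. A Noetherian ring $R$ is called LC-finite if $\operatorname{Ass} H_{\mathfrak a}^i(R)$ is finite for every ideal $\mathfrak a$ of $R$ and every $i\geq 0$. A regular system of parameters of an $r$-dimensional regular local ring $(R,\mathfrak m)$ is a set of $r$ elements generating $\mathfrak m$. The notation $I\supset J$ means containment, not necessarily strict. *)

(* Defs.v *)
From HB Require Import structures.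
From mathcomp Require Import all_boot all_algebra.
From mathcomp Require Import boolp classical_sets cardinality.

Set Implicit Arguments.
Unset Strict Implicit.
Unset Printing Implicit Defensive.

Import GRing.Theory.
Local Open Scope ring_scope.
Local Open Scope quotient_scope.

Record submod_of (R : comNzRingType) (V : lmodType R) (S : submodClosed V) :=
  Submod { submod_val :> V; submod_valP : submod_val \in S }.

Section Submodule.
Context (R : comNzRingType) (V : lmodType R) (S : submodClosed V).
HB.instance Definition _ := [isSub for @submod_val R V S].
HB.instance Definition _ := [Choice of submod_of S by <:].
HB.instance Definition _ := [SubChoice_isSubLmodule of submod_of S by <:].
End Submodule.

(* The library forms the quotient of an additive group by a [zmodClosed]
   predicate, which a [submodClosed] one is not known to be. *)
Definition zmod_of (R : comNzRingType) (V : lmodType R) (S : submodClosed V)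
  : {pred V} := S.

Section ZmodOf.
Context (R : comNzRingType) (V : lmodType R) (S : submodClosed V).
HB.instance Definition _ :=
  GRing.isZmodClosed.Build V (zmod_of S) (GRing.submod_closedB (submodClosedP S)).
End ZmodOf.

Definition quotmod (R : comNzRingType) (V : lmodType R) (S : submodClosed V)
  : Type := Quotient.quot (zmod_of S).

Section QuotientModule.
Context (R : comNzRingType) (V : lmodType R) (S : submodClosed V).
Local Notation Q := (quotmod S).
Local Notation Q0 := (Quotient.quot (zmod_of S)).

HB.instance Definition _ := GRing.Zmodule.on Q.

Lemma quotmodW (P : Q -> Prop) : (forall x, P (\pi_Q0 x)) -> forall q, P q.
Proof. exact: (@quotW _ Q0 P). Qed.

Definition quotmod_scale (a : R) (q : Q) : Q := \pi_Q0 (a *: repr (q : Q0)).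

Lemma quotmod_scale_pi a x : quotmod_scale a (\pi_Q0 x) = \pi_Q0 (a *: x).
Proof.
have xq : repr (\pi_Q0 x) - x \in zmod_of S by rewrite Quotient.idealrBE reprK.
apply/eqP; rewrite -Quotient.idealrBE -scalerBr.
exact: (rpredZ (a : R) (xq : _ \in S)).
Qed.

Let piD (x y : V) : \pi_Q0 (x + y) = (\pi_Q0 x : Q) + (\pi_Q0 y : Q).
Proof. exact: raddfD. Qed.

Fact quotmod_scaleA a b q :
  quotmod_scale a (quotmod_scale b q) = quotmod_scale (a * b) q.
Proof. by move: q; apply: quotmodW => x; rewrite !quotmod_scale_pi scalerA. Qed.

Fact quotmod_scale1 : left_id 1 quotmod_scale.
Proof. by apply: quotmodW => x; rewrite quotmod_scale_pi scale1r. Qed.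

Fact quotmod_scaleDr : right_distributive quotmod_scale +%R.
Proof.
move=> a; apply: quotmodW => x; apply: quotmodW => y.
by rewrite -piD !quotmod_scale_pi scalerDr piD.
Qed.

Fact quotmod_scaleDl q : {morph quotmod_scale^~ q : a b / a + b}.
Proof.
by move=> a b; move: q; apply: quotmodW => x; rewrite !quotmod_scale_pi scalerDl piD.
Qed.

HB.instance Definition _ := GRing.Zmodule_isLmodule.Build R Q
  quotmod_scaleA quotmod_scale1 quotmod_scaleDr quotmod_scaleDl.

End QuotientModule.

(* Unlike [idealr R], this allows the unit ideal. *)
Notation ideal R := (submodClosed (R : comNzRingType)^o).

Section Ideals.
Context (R : comNzRingType).
Implicit Types (I J p m : ideal R) (A : {pred R}).

Definition ideal_span A : {pred R^o} :=
  [pred x | `[< forall I, {subset A <= I} -> x \in I >] ].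

Fact ideal_span_submod A : submod_closed (ideal_span A).
Proof.
split=> [|a x y /asboolP xA /asboolP yA]; apply/asboolP => I AI.
  exact: rpred0.
by rewrite rpredD ?rpredZ ?xA ?yA.
Qed.
HB.instance Definition _ A :=
  GRing.isSubmodClosed.Build R R^o (ideal_span A) (ideal_span_submod A).

Definition ideal_mul I J : ideal R :=
  ideal_span [pred x | `[< exists a b, [/\ a \in I, b \in J & x = a * b] >] ].

Definition ideal_pow I (n : nat) : ideal R :=
  iter n (ideal_mul I) (ideal_span predT).

Definition prime_ideal (p : {pred R}) : Prop :=
  idealr_closed p /\ prime_idealr_closed p.

Definition maximal_ideal m : Prop :=
  (1 : R) \notin m /\
  forall I, {subset m <= I} -> (1 : R) \notin I -> {subset I <= m}.

End Ideals.

Section RegularLocal.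
Context (R : comNzRingType).
Implicit Types (I m : ideal R).

Definition noetherian : Prop :=
  forall I, exists s : seq R, I =i ideal_span (mem s).

Definition local_with_maximal_ideal m : Prop :=
  maximal_ideal m /\ forall n : ideal R, maximal_ideal n -> n =i m.

Definition prime_chain (n : nat) (p : nat -> {pred R}) : Prop :=
  (forall k, (k <= n)%N -> prime_ideal (p k)) /\
  (forall k, (k < n)%N ->
     {subset p k <= p k.+1} /\ ~ {subset p k.+1 <= p k}).

Definition has_krull_dim (d : nat) : Prop :=
  (exists p, prime_chain d p) /\
  (forall n p, prime_chain n p -> (n <= d)%N).

Definition regular_system_of_parameters m (d : nat) (s : seq R) : Prop :=
  [/\ uniq s, size s = d & m =i ideal_span (mem s)].

Definition regular_local_ring m (d : nat) : Prop :=
  [/\ noetherian, local_with_maximal_ideal m, has_krull_dim d &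
      exists s, regular_system_of_parameters m d s].

Definition gen_by_part_of_rsop m (d : nat) I : Prop :=
  exists s t : seq R,
    regular_system_of_parameters m d (s ++ t) /\ I =i ideal_span (mem s).

End RegularLocal.

Record complex (R : comNzRingType) := Complex {
  cterm :> nat -> lmodType R;
  cdiff : forall i, {linear cterm i -> cterm i.+1};
  cdiffK : forall i (x : cterm i), cdiff i.+1 (cdiff i x) = 0
}.
Arguments cdiff {R} C i : rename.
Arguments cdiffK {R} C i x : rename.

Section Cohomology.
Context (R : comNzRingType) (C : complex R).

Definition is_cocycle i : {pred C i} := [pred x | cdiff C i x == 0].

Fact is_cocycle_submod i : submod_closed (@is_cocycle i).
Proof.
split=> [|a x y /eqP dx /eqP dy]; apply/eqP; first exact: raddf0.
by rewrite linearP dx dy scaler0 addr0.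
Qed.
HB.instance Definition _ i :=
  GRing.isSubmodClosed.Build R (C i) (@is_cocycle i) (is_cocycle_submod i).

Definition cocycles i : submodClosed (C i) := @is_cocycle i.

Definition is_coboundary i : {pred C i} :=
  match i with
  | 0%N => pred1 0
  | j.+1 => [pred x | `[< exists y : C j, x = cdiff C j y >] ]
  end.

Fact is_coboundary_submod i : submod_closed (@is_coboundary i).
Proof.
case: i => [|i].
  by split=> [|a x y /eqP -> /eqP ->]; apply/eqP; rewrite ?scaler0 ?addr0.
split=> [|a _ _ /asboolP[u ->] /asboolP[v ->]]; apply/asboolP.
  by exists 0; rewrite raddf0.
by exists (a *: u + v); rewrite linearP.
Qed.

Definition coboundary_of_cocycle i : {pred submod_of (cocycles i)} :=
  [pred z | submod_val z \in @is_coboundary i].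

Fact coboundary_of_cocycle_submod i : submod_closed (@coboundary_of_cocycle i).
Proof.
have [im0 imP] := is_coboundary_submod i.
by split=> [|a x y xB yB]; [exact: im0 | exact: (imP a)].
Qed.
HB.instance Definition _ i :=
  GRing.isSubmodClosed.Build R (submod_of (cocycles i))
    (@coboundary_of_cocycle i) (coboundary_of_cocycle_submod i).

Definition coboundaries i : submodClosed (submod_of (cocycles i)) :=
  @coboundary_of_cocycle i.

Definition cohomology i : lmodType R := quotmod (coboundaries i).

End Cohomology.

Definition injective_module (R : comNzRingType) (E : lmodType R) : Prop :=
  forall (A B : lmodType R) (f : {linear A -> B}) (g : {linear A -> E}),
    injective f -> exists h : {linear B -> E}, forall a, h (f a) = g a.

Record injective_resolution (R : comNzRingType) (M : lmodType R) := InjRes {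
  res_complex :> complex R;
  res_aug : {linear M -> res_complex 0%N};
  res_inj : forall i, injective_module (res_complex i);
  res_aug_inj : injective res_aug;
  res_exact0 : forall x : res_complex 0%N,
    cdiff res_complex 0%N x = 0 <-> exists y, x = res_aug y;
  res_exactS : forall i (x : res_complex i.+1),
    cdiff res_complex i.+1 x = 0 <-> exists y, x = cdiff res_complex i y
}.

Section Torsion.
Context (R : comNzRingType) (I : ideal R).

Definition is_torsion (V : lmodType R) : {pred V} :=
  [pred x | `[< exists n, forall a : R, a \in ideal_pow I n -> a *: x = 0 >] ].

Lemma ideal_pow_sub n k : {subset ideal_pow I (n + k) <= ideal_pow I k}.
Proof.
elim: n => // n IHn x xI; apply: IHn; move: xI; rewrite addSn /=.
move/asboolP; apply=> y /asboolP[a [b [_ bI ->]]].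
exact: (rpredZ (a : R) bI).
Qed.

Fact is_torsion_submod V : submod_closed (@is_torsion V).
Proof.
split=> [|a x y /asboolP[n xn] /asboolP[k yk]]; apply/asboolP.
  by exists 0%N => a _; rewrite scaler0.
exists (n + k)%N => b bI; rewrite scalerDr scalerA mulrC -scalerA.
rewrite xn ?yk ?scaler0 ?addr0 //; first exact: (@ideal_pow_sub n k).
by apply: (@ideal_pow_sub k n); rewrite addnC.
Qed.
HB.instance Definition _ V :=
  GRing.isSubmodClosed.Build R V (@is_torsion V) (is_torsion_submod V).

Definition torsion (V : lmodType R) : submodClosed V := @is_torsion V.

Context (V W : lmodType R) (f : {linear V -> W}).

Fact torsion_map_subproof (x : submod_of (torsion V)) :
  f (val x) \in torsion W.
Proof.
case: x => x /= /asboolP[n xn]; apply/asboolP; exists n => a aI.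
by rewrite -linearZ xn ?raddf0.
Qed.

Definition torsion_map (x : submod_of (torsion V)) : submod_of (torsion W) :=
  Sub (f (val x)) (torsion_map_subproof x).

Fact torsion_map_linear : linear torsion_map.
Proof. by move=> a x y; apply: val_inj; rewrite /= !linearP. Qed.
HB.instance Definition _ :=
  GRing.isLinear.Build R (submod_of (torsion V)) (submod_of (torsion W))
    _ torsion_map torsion_map_linear.

End Torsion.

Section LocalCohomology.
Context (R : comNzRingType) (I : ideal R).

Fact torsion_complex_subproof (C : complex R) i
    (x : submod_of (torsion I (C i))) :
  torsion_map (cdiff C i.+1) (torsion_map (cdiff C i) x) = 0.
Proof. by apply: val_inj; exact: cdiffK. Qed.

Definition torsion_complex (C : complex R) : complex R :=
  @Complex R (fun i => submod_of (torsion I (C i)))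
    (fun i => torsion_map (cdiff C i))
    (@torsion_complex_subproof C).

(* The module $H^i_I(M)$, computed from the injective resolution [E] of [M]. *)
Definition local_cohomology (M : lmodType R) (E : injective_resolution M)
    (i : nat) : lmodType R :=
  cohomology (torsion_complex E) i.

End LocalCohomology.

Definition Ass (R : comNzRingType) (M : lmodType R) : set {pred R} :=
  [set p | prime_ideal p /\ exists x : M, p =i [pred a | a *: x == 0] ]%classic.

(* $H^i_I(M)$ is only defined up to isomorphism, through the choice of an
   injective resolution, and Ass is invariant under isomorphism: quantifying
   over all resolutions fixes no particular choice. *)
Definition finite_Ass_lc (R : comNzRingType) (I : ideal R) (i : nat)
    (M : lmodType R) : Prop :=
  forall E : injective_resolution M, finite_set (Ass (local_cohomology I E i)).

Definition LC_finite (R : comNzRingType) : Prop :=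
  noetherian R /\ forall (a : ideal R) (i : nat), finite_Ass_lc a i R^o.

(* Main.v *)
(* The finiteness holds because Ass H^i_I(J) is contained in {I}: every [a]
   outside [I] is a nonzerodivisor on H^i_I(J).

   By a Steinitz exchange modulo m^2, J = (x_1, ..., x_l) and
   I = (x_1, ..., x_l, z_1, ..., z_h) where the x's and z's together are part of
   a regular system of parameters.  A regular local ring being a domain, every
   subset of such a system generates a prime ideal; hence [a] is regular modulo
   any powers of these elements.

   Let E be an injective resolution of J.  Elements of E killed by powers of I
   are killed by suitable powers ys of the z's and x's, so it is enough to show
   that [a] is regular on the cohomology of the subcomplex E[ys], whatever lower
   bound is imposed on the exponents.  The powers are added one at a time, first
   those of the z's, then those of the x's; for each new y, multiplication by y
   is surjective on E[ys], and the long exact sequence of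
   0 -> E[y, ys] -> E[ys] -> E[ys] -> 0 computes the next step.  After j steps
   the cohomology is J/(ys)J in degree j and vanishes above; in lower degrees it
   is zero during the first phase, and killed by c-th powers of elements of J
   during the second one, so that the next y, a large power of an element of J,
   acts on it as zero.  Thus only the regularity of [a] on J/(ys)J matters. *)
Require Import Defs.
From HB Require Import structures.
From mathcomp Require Import all_boot all_algebra.
From mathcomp Require Import boolp classical_sets cardinality.
From Stdlib Require Import Ring.

Set Implicit Arguments.
Unset Strict Implicit.
Unset Printing Implicit Defensive.

Import GRing.Theory.
Local Open Scope ring_scope.

(** * Ideals, products of an ideal with a list, and spans *)

Section Ideals.
Context (R : comNzRingType).

Let radd (x y : R) : R := x + y.
Let rmul (x y : R) : R := x * y.
Let rsub (x y : R) : R := x - y.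
Let ropp (x : R) : R := - x.
Let rzero : R := 0.
Let rone : R := 1.

Fact stdlib_ring_theory : ring_theory rzero rone radd rmul rsub ropp eq.
Proof.
by split=> *; rewrite /radd /rmul /rsub /ropp /rzero /rone
     ?(add0r, mul1r, addrA, mulrA, mulrDl, addrN) // (addrC, mulrC).
Qed.
Add Ring R_ring : stdlib_ring_theory.

Ltac cring :=
  repeat match goal with
  | |- context[@GRing.add _ ?x ?y] => change (@GRing.add _ x y) with (radd x y)
  | |- context[@GRing.mul _ ?x ?y] => change (@GRing.mul _ x y) with (rmul x y)
  | |- context[@GRing.opp _ ?x] => change (@GRing.opp _ x) with (ropp x)
  | |- context[@GRing.zero _] => change (@GRing.zero _) with rzero
  | |- context[@GRing.one _] => change (@GRing.one _) with rone
  end;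
  match goal with |- @eq _ ?x ?y => change (@eq R x y) end; ring.

Implicit Types (A B K P Q : R -> Prop) (s t : seq R) (a b c x y z : R).

(* Ideals are handled as [Prop]-valued predicates; [pack_ideal] and
   [ideal_is_ideal] below convert to and from the bundled [ideal R]. *)
Definition is_ideal A := A 0 /\ forall a x y, A x -> A y -> A (a * x + y).

Lemma ideal0 A : is_ideal A -> A 0. Proof. by case. Qed.

Lemma idealM A a x : is_ideal A -> A x -> A (a * x).
Proof. by move=> [A0 AD] Ax; rewrite -[a * x]addr0; apply: AD. Qed.

Lemma idealMr A a x : is_ideal A -> A x -> A (x * a).
Proof. by rewrite mulrC; apply: idealM. Qed.

Lemma idealD A x y : is_ideal A -> A x -> A y -> A (x + y).
Proof. by move=> [_ AD] Ax Ay; rewrite -[x]mul1r; apply: AD. Qed.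

Lemma idealN A x : is_ideal A -> A x -> A (- x).
Proof. by move=> hA Ax; rewrite -mulN1r; apply: idealM. Qed.

Lemma idealB A x y : is_ideal A -> A x -> A y -> A (x - y).
Proof. by move=> hA Ax Ay; apply: idealD => //; apply: idealN. Qed.

Lemma idealDl A x y : is_ideal A -> A x -> A (x + y) -> A y.
Proof. by move=> hA Ax Axy; rewrite -[y](addKr x) addrC; apply: idealB. Qed.

Definition whole : R -> Prop := fun=> True.

Definition add_elt A x : R -> Prop := fun y => exists a b, A a /\ y = a + b * x.

Lemma add_elt_ideal A x : is_ideal A -> is_ideal (add_elt A x).
Proof.
move=> hA; split=> [|c _ _ [a1 [b1 [Aa1 ->]]] [a2 [b2 [Aa2 ->]]]].
  by exists 0, 0; split; [exact: ideal0 | rewrite mul0r addr0].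
exists (c * a1 + a2), (c * b1 + b2); split; last by cring.
by apply: idealD => //; apply: idealM.
Qed.

Lemma add_eltl A x y : A y -> add_elt A x y.
Proof. by move=> Ay; exists y, 0; rewrite mul0r addr0. Qed.

Lemma add_eltr A x : is_ideal A -> add_elt A x x.
Proof. by move=> hA; exists 0, 1; rewrite mul1r add0r; split=> //; apply: ideal0. Qed.

Definition colon A b : R -> Prop := fun x => A (x * b).

Lemma colon_ideal A b : is_ideal A -> is_ideal (colon A b).
Proof.
move=> hA; split=> [|c x y]; rewrite /colon ?mul0r; first exact: ideal0.
by move=> Ax Ay; rewrite mulrDl -mulrA; apply: idealD => //; apply: idealM.
Qed.

(** For an ideal [K] this is the product of [K] with the ideal generated by [s]. The cases
    [K = whole] and [K = span s] yield the ideals (ys) and (ys) J. *)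
Fixpoint comb K s x : Prop :=
  if s is g :: s' then exists a y, [/\ K a, comb K s' y & x = a * g + y]
  else x = 0.

Lemma comb_ideal K s : is_ideal K -> is_ideal (comb K s).
Proof.
move=> hK; elim: s => [|g s IHs] /=.
  by split=> // a x y -> ->; rewrite mulr0 addr0.
split=> [|c _ _ [a1 [y1 [K1 s1 ->]]] [a2 [y2 [K2 s2 ->]]]].
  exists 0, 0; split; [exact: ideal0 | exact: ideal0 | by rewrite mul0r addr0].
exists (c * a1 + a2), (c * y1 + y2); split; last by cring.
- by apply: idealD => //; apply: idealM.
- by apply: idealD => //; apply: idealM.
Qed.

Lemma comb_elt K s a g : is_ideal K -> K a -> g \in s -> comb K s (a * g).
Proof.
move=> hK Ka; elim: s => // h s IHs; rewrite inE => /orP[/eqP->|gs].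
  by exists a, 0; split=> //; [exact: ideal0 (comb_ideal _ hK) | rewrite addr0].
by exists 0, (a * g); split; [exact: ideal0 | exact: IHs | rewrite mul0r add0r].
Qed.

Lemma comb_min K A s x : is_ideal A ->
  (forall a g, K a -> g \in s -> A (a * g)) -> comb K s x -> A x.
Proof.
move=> hA; elim: s x => [|g s IHs] x KA /=; first by move=> ->; apply: ideal0.
move=> [a [y [Ka sy ->]]]; apply: idealD => //.
  by apply: KA; rewrite ?mem_head.
by apply: IHs sy => b h Kb hs; apply: KA; rewrite ?inE ?hs ?orbT.
Qed.

Lemma comb_subset K K' s t x : is_ideal K' -> (forall a, K a -> K' a) ->
  {subset s <= t} -> comb K s x -> comb K' t x.
Proof.
move=> hK' KK' st; apply: comb_min; first exact: comb_ideal.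
by move=> a g Ka gs; apply: comb_elt => //; [apply: KK' | apply: st].
Qed.

Lemma comb_mul K s b x : is_ideal K -> K b -> comb whole s x -> comb K s (b * x).
Proof.
move=> hK Kb sx; have hc := colon_ideal b (comb_ideal s hK).
suff: colon (comb K s) b x by rewrite /colon mulrC.
apply: comb_min sx => // a g _ gs; rewrite /colon mulrAC.
by apply: comb_elt => //; apply: idealM.
Qed.

Definition span s := comb whole s.

Lemma span_ideal s : is_ideal (span s).
Proof. exact: comb_ideal. Qed.
Hint Resolve span_ideal : core.

Lemma span_elt s g : g \in s -> span s g.
Proof. by move=> gs; rewrite -[g]mul1r; apply: comb_elt. Qed.

Lemma span_min A s x : is_ideal A -> (forall g, g \in s -> A g) -> span s x -> A x.
Proof.
by move=> hA sA; apply: comb_min => // a g _ /sA Ag; apply: idealM.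
Qed.

Lemma span_subset s t x : {subset s <= t} -> span s x -> span t x.
Proof. by move=> st; apply: comb_subset. Qed.

Lemma comb_span K s x : comb K s x -> span s x.
Proof. by apply: comb_subset => // a. Qed.

Lemma span_cons g s x : span (g :: s) x <-> add_elt (span s) g x.
Proof.
split=> [[a [y [_ sy ->]]]|[a [b [sa ->]]]].
  by exists y, a; rewrite addrC.
by exists b, a; rewrite addrC.
Qed.

Definition below A B := forall x, A x -> B x.

Section Packed.
Context (A : R -> Prop) (hA : is_ideal A).
Definition packed_pred of is_ideal A : {pred R^o} := [pred x | `[< A x >]].
Fact packed_submod : submod_closed (packed_pred hA).
Proof.
split=> [|a x y /asboolP Ax /asboolP Ay]; apply/asboolP; first exact: ideal0.
by apply: idealD => //; apply: (@idealM A a x).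
Qed.
HB.instance Definition _ :=
  GRing.isSubmodClosed.Build R R^o (packed_pred hA) packed_submod.
Definition pack_ideal : ideal R := packed_pred hA.
End Packed.

Lemma pack_idealE A (hA : is_ideal A) x : x \in pack_ideal hA <-> A x.
Proof. by split=> [/asboolP|?] //; apply/asboolP. Qed.

Lemma ideal_is_ideal (I : ideal R) : is_ideal (fun x => x \in I).
Proof.
have [I0 IP] := GRing.submodClosedP I.
by split=> // a x y xI yI; apply: (IP a).
Qed.

Lemma ideal_spanE s x : x \in ideal_span (mem s) <-> span s x.
Proof.
split=> [/asboolP/(_ (pack_ideal (span_ideal s)))|sx].
  by move/(_ _)/pack_idealE; apply=> g gs; apply/pack_idealE/span_elt.
apply/asboolP => I sI; apply: (span_min (ideal_is_ideal I)) sx => g; exact: sI.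
Qed.

(** * Noetherian rings *)

Definition noeth := forall A, is_ideal A -> exists s, forall x, A x <-> span s x.

Lemma noetherian_noeth : noetherian R -> noeth.
Proof.
move=> nR A hA; have [s sP] := nR (pack_ideal hA); exists s => x.
by rewrite -(pack_idealE hA) sP; apply: ideal_spanE.
Qed.

(** Without a maximal member, choice yields a strictly ascending chain; its union is finitely
    generated, hence already reached at a finite stage. *)
Lemma noeth_max (F : (R -> Prop) -> Prop) : noeth ->
  (exists A, is_ideal A /\ F A) ->
  exists A, [/\ is_ideal A, F A &
    forall B, is_ideal B -> F B -> below A B -> below B A].
Proof.
move=> nR [A0 hA0]; apply: contrapT => noMax.
pose T := {A | is_ideal A /\ F A}.
have [f fP] : {f : T -> T & forall X : T, below (sval X) (sval (f X)) /\
    ~ below (sval (f X)) (sval X)}.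
  apply: (@choice T T (fun X Y => below (sval X) (sval Y) /\
    ~ below (sval Y) (sval X))) => -[A [hA FA]]; apply: contrapT => noB; apply: noMax.
  exists A; split=> // B hB FB AB; apply: contrapT => nBA; apply: noB.
  by exists (exist _ B (conj hB FB)).
pose c n := iter n f (exist _ A0 hA0).
have cmono n k : below (sval (c n)) (sval (c (k + n)%N)).
  by elim: k => [|k IHk] x // /IHk; apply: (fP _).1.
have hc n : is_ideal (sval (c n)) by case: (c n) => ? [].
pose U x := exists n, sval (c n) x.
have hU : is_ideal U.
  split=> [|a x y [n cx] [k cy]]; first by exists 0%N; apply: ideal0.
  exists (n + k)%N; apply: (hc _).2; last exact: cmono.
  by rewrite addnC; apply: cmono.
have [s sP] := nR U hU.
have [n sn] : exists n, forall g, g \in s -> sval (c n) g.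
  have : forall g, g \in s -> U g by move=> g gs; apply/sP/span_elt.
  elim: (s) => [|g t IHt] tU; first by exists 0%N.
  have [|n tn] := IHt; first by move=> h ht; apply: tU; rewrite inE ht orbT.
  have [k gk] := tU g (mem_head _ _); exists (n + k)%N => h.
  rewrite inE => /orP[/eqP->|/tn]; first exact: cmono.
  by rewrite addnC; apply: cmono.
apply: (fP (c n)).2 => x fx; apply: span_min (hc n) sn _.
by apply/sP; exists n.+1.
Qed.

Lemma noeth_ind (F : (R -> Prop) -> Prop) : noeth ->
  (forall A, is_ideal A ->
    (forall B, is_ideal B -> below A B -> ~ below B A -> F B) -> F A) ->
  forall A, is_ideal A -> F A.
Proof.
move=> nR Find A hA; apply: contrapT => nFA.
have [|B [hB nFB Bmax]] := @noeth_max (fun B => ~ F B) nR; first by exists A.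
apply: nFB; apply: Find => // C hC BC nCB; apply: contrapT => nFC.
exact/nCB/Bmax.
Qed.

(** * Primes, saturation and Nakayama's lemma *)

Definition is_prime P :=
  [/\ is_ideal P, ~ P 1 & forall a b, P (a * b) -> P a \/ P b].

Lemma primeX P a n : is_prime P -> P (a ^+ n) -> P a.
Proof.
move=> [hP P1 PM]; elim: n => [|n IHn]; first by rewrite expr0.
by rewrite exprS => /PM[].
Qed.

Lemma notprimeM P a b : is_prime P -> ~ P a -> ~ P b -> ~ P (a * b).
Proof. by move=> [_ _ PM] nPa nPb /PM[]. Qed.

(* The preimage in [R] of the extension of [A] to the localization at [P]. *)
Definition saturation P A : R -> Prop := fun x => exists a, ~ P a /\ A (a * x).

Definition saturated P A := below (saturation P A) A.

Lemma saturation_ideal P A : is_prime P -> is_ideal A -> is_ideal (saturation P A).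
Proof.
move=> hP hA; have [_ P1 _] := hP.
split=> [|a x y [s [nPs Asx]] [t [nPt Aty]]].
  by exists 1; rewrite mulr0; split=> //; apply: ideal0.
exists (s * t); split; first exact: notprimeM.
rewrite (_ : _ * _ = (t * a) * (s * x) + s * (t * y)); last by cring.
by apply: idealD => //; apply: idealM.
Qed.

Lemma sub_saturation P A : is_prime P -> below A (saturation P A).
Proof. by move=> [_ P1 _] x Ax; exists 1; rewrite mul1r. Qed.

Lemma saturationK P A : is_prime P -> saturated P (saturation P A).
Proof.
move=> hP x [s [nPs [t [nPt Atsx]]]]; exists (t * s); rewrite -mulrA; split=> //.
exact: notprimeM.
Qed.

Lemma saturationS P A B : below A B -> below (saturation P A) (saturation P B).
Proof. by move=> AB x [s [? /AB]]; exists s. Qed.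

(* Nakayama's lemma in the localization at [P]. *)
Lemma nakayama P A s : is_prime P -> is_ideal A ->
  (forall g, g \in s -> exists a c e, [/\ ~ P a, A c, comb P s e & a * g = c + e]) ->
  forall g, g \in s -> saturation P A g.
Proof.
move=> hP; have [iP P1 _] := hP.
elim: s A => // g s IHs A hA H.
have ihS := add_elt_ideal g hA.
(* The other generators satisfy the hypothesis with [A + (g)] in place of [A]. *)
have sS : forall h, h \in s -> saturation P (add_elt A g) h.
  apply: IHs => // h hs; have [|t [c [_ [nPt Ac [a [e [Pa se ->]]] thE]]]] := H h.
    by rewrite inE hs orbT.
  by exists t, (c + a * g), e; split=> //; [exists c, a | rewrite thE addrA].
pose S x := exists c p, [/\ A c, P p & x = c + p * g].
have hS : is_ideal S.
  split=> [|k _ _ [c1 [p1 [Ac1 Pp1 ->]]] [c2 [p2 [Ac2 Pp2 ->]]]].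
    exists 0, 0; split; [exact: ideal0 | exact: ideal0 | by rewrite mul0r addr0].
  exists (k * c1 + c2), (k * p1 + p2); split; last by cring.
  - by apply: idealD => //; apply: idealM.
  - by apply: idealD => //; apply: idealM.
have eS e : comb P s e -> saturation P S e.
  apply: comb_min; first exact: saturation_ideal.
  move=> p h Pp /sS[t [nPt [c [b [Ac thE]]]]]; exists t; split=> //.
  exists (p * c), (p * b); split; [exact: idealM | exact: idealMr |].
  by rewrite mulrCA thE; cring.
have gA : saturation P A g.
  have [t [c [_ [nPt Ac [a [e [Pa se ->]]] gE]]]] := H g (mem_head _ _).
  have [t' [nPt' [c' [p [Ac' Pp eE]]]]] := eS e se.
  (* This multiplier is outside [P], because [t' * t] is and [a], [p] are in [P]. *)
  exists (t' * t - (t' * a + p)); split.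
    move=> Pq; apply: (notprimeM hP nPt' nPt).
    rewrite -[t' * t](subrK (t' * a + p)); apply: idealD => //.
    by apply: idealD => //; apply: idealM.
  rewrite (_ : _ * g = t' * c + c'); first by apply: idealD => //; apply: idealM.
  rewrite mulrBl -mulrA gE 2!mulrDr eE; cring.
move=> h; rewrite inE => /orP[/eqP->//|/sS[t [nPt [c [b [Ac thE]]]]]].
have [t' [nPt' Ag]] := gA.
exists (t' * t); split; first exact: notprimeM.
rewrite -mulrA thE mulrDr mulrCA; apply: idealD => //; exact: idealM.
Qed.

(** * The principal ideal theorem *)

Lemma descending_below (B : nat -> R -> Prop) n k :
  (forall i, below (B i.+1) (B i)) -> (n <= k)%N -> below (B k) (B n).
Proof.
move=> Bdec; elim: k => [|k IHk]; first by rewrite leqn0 => /eqP->.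
by rewrite leq_eqVlt => /predU1P[->//|/IHk Bkn x /Bdec/Bkn].
Qed.

Definition descending P A (B : nat -> R -> Prop) :=
  forall n, [/\ is_ideal (B n), saturated P (B n), below A (B n) &
                below (B n.+1) (B n)].

(* The localization of [R / X] at a prime minimal over [X] is artinian. *)
Lemma saturated_dcc P X : noeth -> is_prime P ->
  (forall Q, is_prime Q -> below X Q -> below Q P -> below P Q) ->
  forall A, is_ideal A -> below X A -> forall B : nat -> R -> Prop, descending P A B ->
  exists n, forall k, (n <= k)%N -> below (B k) (B k.+1).
Proof.
move=> nR hP Pmin; apply: (noeth_ind nR) => A hA IH XA B hB.
have Bi n : is_ideal (B n) by case: (hB n).
have Bsat n : saturated P (B n) by case: (hB n).
have AB n : below A (B n) by case: (hB n).
have Bdec n : below (B n.+1) (B n) by case: (hB n).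
(* If [A] is not inside [P], every saturated ideal over [A] is the whole ring. *)
have [AP|] := pselect (below A P); last first.
  move=> nAP; have [s [As nPs]] : exists s : R, A s /\ ~ P s.
    apply: contrapT => noS; apply: nAP => s As; apply: contrapT => nPs.
    by apply: noS; exists s.
  exists 0%N => k _ x _; apply: Bsat; exists s; split=> //.
  by apply/AB; apply: idealMr.
have hS := saturation_ideal hP hA.
(* [C] is an associated prime of [R] modulo the saturation of [A]. It lies between [X] and [P], so
   it contains [P] by minimality. *)
have [|C [hC [b [nSb CE]] Cmax]] := @noeth_max (fun C => exists b,
    ~ saturation P A b /\ C = colon (saturation P A) b) nR.
  exists (colon (saturation P A) 1); split; first exact: colon_ideal.
  by exists 1; split=> // -[s [nPs]]; rewrite mulr1 => /AP.
have Cprime : is_prime C.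
  split=> //; first by rewrite CE /colon mul1r.
  move=> x y Cxy; have [Cx|nCx] := pselect (C x); [by left | right].
  apply: (Cmax (colon (saturation P A) (x * b))).
  - exact: colon_ideal.
  - by exists (x * b); split=> //; move: nCx; rewrite CE.
  - move=> z; rewrite CE /colon => Sz.
    by rewrite (_ : _ * _ = x * (z * b)); [apply: idealM | cring].
  - by move: Cxy; rewrite CE /colon (_ : _ * b = y * (x * b)) //; cring.
have PC : below P C.
  apply: Pmin => // [x /XA Ax|x]; rewrite CE /colon.
    by apply: sub_saturation => //; apply: idealMr.
  move=> Sxb; apply: contrapT => nPx; apply: nSb.
  by apply: saturationK => //; exists x.
have IHb : forall B' : nat -> R -> Prop, descending P (add_elt A b) B' ->
    exists n, forall k, (n <= k)%N -> below (B' k) (B' k.+1).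
  apply: IH; first exact: add_elt_ideal.
  - by move=> x; apply: add_eltl.
  - move=> AbA; apply: nSb; apply: sub_saturation => //.
    exact/AbA/add_eltr.
  - by move=> x /XA; apply: add_eltl.
have [allb|] := pselect (forall n, B n b).
  apply: IHb => n; split=> // _ [x [y [Ax ->]]]; apply: idealD => //.
    exact: AB.
  by apply: idealM.
move=> notall; have [n1 nB1] : exists n, ~ B n b.
  by apply: contrapT => noN; apply: notall => n; apply: contrapT => ?; case: noN; exists n.
have [n2 stab] : exists n, forall k, (n <= k)%N ->
    below (saturation P (add_elt (B k) b)) (saturation P (add_elt (B k.+1) b)).
  apply: (IHb (fun k => saturation P (add_elt (B k) b))) => n; split.
  - exact/saturation_ideal/add_elt_ideal.
  - exact: saturationK.
  - move=> _ [x [y [Ax ->]]]; apply: sub_saturation => //.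
    by exists x, y; split=> //; apply: AB.
  - by apply: saturationS => _ [x [y [Bx ->]]]; exists x, y; split=> //; apply: Bdec.
exists (maxn n1 n2) => k; rewrite geq_max => /andP[n1k n2k] a Ba.
have [|s [nPs [c [r [Bc saE]]]]] := stab k n2k a.
  by apply: sub_saturation => //; apply: add_eltl.
apply: (Bsat k.+1); exists s; split=> //; rewrite saE; apply: idealD => //.
(* [r * b] is in [B k], so [r] outside [P] would put [b] in [B k] and then in [B n1]. Hence [r] is
   in [C], and [r * b] is in the saturation of [A], thus in [B k.+1]. *)
have Pr : P r.
  apply: contrapT => nPr; apply: nB1; suff Bkb : B k b.
    exact: (descending_below Bdec n1k Bkb).
  apply: (Bsat k); exists r; split=> //.
  by apply: (idealDl (Bi k) (Bdec _ _ Bc)); rewrite -saE; apply: idealM.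
have /PC := Pr; rewrite CE => -[t [nPt Atrb]].
by apply: Bsat; exists t; split=> //; apply: AB.
Qed.

(* Krull's principal ideal theorem in [R / P0]: with [y] in [Q] but not in
   [P0], the decreasing chain of the contractions of [y ^+ n R_Q] shows that
   [Q = P0] if [P] is minimal over [P0 + x]. *)
Lemma krull_principal P0 Q P x : noeth ->
  is_prime P0 -> is_prime Q -> is_prime P -> below P0 Q -> ~ below Q P0 ->
  below Q P -> P x -> ~ Q x ->
  exists q, [/\ is_prime q, below P0 q, q x, below q P & ~ below P q].
Proof.
move=> nR hP0 hQ hP P0Q nQP0 QP Px nQx; apply: contrapT => noq; apply: nQP0 => y Qy.
apply: contrapT => nP0y.
have [iP0 _ P0M] := hP0; have [iQ _ _] := hQ; have [iP _ _] := hP.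
have hX := add_elt_ideal x iP0.
pose Y n := saturation Q (add_elt P0 (y ^+ n)).
have hY n : is_ideal (Y n) by exact/saturation_ideal/add_elt_ideal.
have Ydec n : below (Y n.+1) (Y n).
  apply: saturationS => _ [a [b [P0a ->]]]; exists a, (b * y).
  by rewrite exprS mulrA.
(* By [noq], [P] is minimal over [P0 + (x)], so the chain condition applies to the saturations of
   the [Y k + (x)]. *)
have [n stab] : exists n, forall k, (n <= k)%N ->
    below (saturation P (add_elt (Y k) x)) (saturation P (add_elt (Y k.+1) x)).
  apply: (@saturated_dcc P (add_elt P0 x) nR hP _ _ hX _
    (fun k => saturation P (add_elt (Y k) x))) => //.
    move=> q hq Xq qP z Pz; apply: contrapT => nqz; apply: noq; exists q.
    split=> // [w P0w||]; first exact/Xq/add_eltl.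
      exact/Xq/add_eltr.
    by move=> /(_ z Pz).
  move=> k; split.
  - exact/saturation_ideal/add_elt_ideal.
  - exact: saturationK.
  - move=> _ [a [b [P0a ->]]]; apply: sub_saturation => //; exists a, b; split=> //.
    by apply: sub_saturation => //; apply: add_eltl.
  - apply: saturationS => _ [a [b [Ya ->]]]; exists a, b; split=> //; exact: Ydec.
have [s sE] := nR (Y n) (hY n).
(* As [x] is outside [Q] and [Y n] is saturated at [Q], stability says that locally at [P] the ideal
   [Y n] is inside [Y n.+1 + x Y n]; Nakayama removes the second term. *)
have YS g : g \in s -> Y n.+1 g.
  move=> gs; have Yg : Y n g by apply/sE/span_elt.
  have : saturation P (Y n.+1) g.
    apply: (nakayama (s := s)) => // h hs.
    have Yh : Y n h by apply/sE/span_elt.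
    have [|t [nPt [c [r [Yc thE]]]]] := stab n (leqnn n) h.
      by apply: sub_saturation => //; apply: add_eltl.
    exists t, c, (r * x); split=> //; rewrite mulrC; apply: comb_mul => //; apply/sE.
    apply: saturationK => //; exists x; split=> //; rewrite mulrC.
    by apply: (idealDl (hY n) (Ydec _ _ Yc)); rewrite -thE; apply: idealM.
  move=> [t [nPt Yt]]; apply: saturationK => //; exists t; split=> //.
  by move=> /QP.
(* Since [y] is outside [P0], the factor [t - r * y] is in [P0], hence in [Q]; as [y] is in [Q], so
   is [t]. *)
have [t [nQt [a [r [P0a tE]]]]] : Y n.+1 (y ^+ n).
  apply: span_min (hY _) YS _; apply/sE; apply: sub_saturation => //.
  exact: add_eltr.
have : P0 ((t - r * y) * y ^+ n).
  by rewrite mulrBl tE -mulrA -exprS addrK.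
case/P0M => [/P0Q Qty|/(primeX hP0)//]; apply: nQt.
by rewrite -[t](subrK (r * y)); apply: idealD => //; apply: idealM.
Qed.

(** * Regular systems of parameters *)

(** Ranging over all rearrangements makes the notion stable under permutation and passage to a
    sublist. *)
Definition prime_sequence s :=
  (forall s1 s2, perm_eq (s1 ++ s2) s -> is_prime (span s1)) /\
  (forall s1 x s2, perm_eq (s1 ++ x :: s2) s -> ~ span s1 x).

Section Local.
Context (m : R -> Prop) (nR : noeth) (m_prime : is_prime m).
Context (m_unit : forall x, ~ m x -> exists y, y * x = 1).

Let m_ideal : is_ideal m. Proof. by case: m_prime. Qed.

Lemma prime_below_max P : is_prime P -> below P m.
Proof.
move=> [iP P1 _] x Px; apply: contrapT => /m_unit[y yx]; apply: P1.
by rewrite -yx; apply: idealM.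
Qed.

(** For a prime [P] this says that [m / P] has height at least [n]. *)
Fixpoint chain_to_max n P :=
  if n is k.+1 then
    exists Q, [/\ is_prime Q, below P Q, ~ below Q P & chain_to_max k Q]
  else below m P.

(** Krull's theorem moves [x] down the chain: a member missing [x], followed by one containing it,
    can be replaced by a prime containing [x]. *)
Lemma chain_to_max_through n P x : m x -> is_prime P -> chain_to_max n.+1 P ->
  exists Q, [/\ is_prime Q, below P Q, ~ below Q P, Q x & chain_to_max n Q].
Proof.
move=> mx; elim: n P => [|n IHn] P hP [Q [hQ PQ nQP cQ]].
  by exists Q; split=> //; apply: cQ.
have [Q' [hQ' QQ' nQ'Q Q'x cQ']] := IHn Q hQ cQ.
have [Qx|nQx] := pselect (Q x); first by exists Q.
have [q [hq Pq qx qQ' nQ'q]] := krull_principal nR hP hQ hQ' PQ nQP QQ' Q'x nQx.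
exists q; split=> //; first by move=> /(_ x qx)/PQ.
by exists Q'.
Qed.

(** Each element of [t] is absorbed into the chain at the cost of one inclusion; once [t] is
    exhausted, the bottom prime contains [m]. *)
Lemma krull_height t s P : (forall x, m x <-> span (s ++ t) x) ->
  is_prime P -> (forall g, g \in s -> P g) -> ~ chain_to_max (size t).+1 P.
Proof.
elim: t s P => [|x t IHt] s P mE hP sP; have [iP _ _] := hP.
  move=> [Q [hQ _ nQP _]]; apply: nQP => y /(prime_below_max hQ)/mE.
  by rewrite cats0; apply: span_min.
have mx : m x by apply/mE/span_elt; rewrite mem_cat mem_head orbT.
move=> /(chain_to_max_through mx hP)[Q [hQ PQ _ Qx]].
apply: (IHt (rcons s x)) => //; first by rewrite cat_rcons.
by move=> g; rewrite mem_rcons inE => /orP[/eqP->|/sP/PQ].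
Qed.

Lemma nakayama_local A s : is_ideal A ->
  (forall g, g \in s -> exists c e, [/\ A c, comb m s e & g = c + e]) ->
  forall x, span s x -> A x.
Proof.
move=> hA H x; apply: span_min => // g gs.
have [|a [/m_unit[b ba] Aag]] := nakayama m_prime hA _ gs.
  move=> h /H[c [e [Ac se hE]]]; exists 1, c, e; rewrite mul1r; split=> //.
  by case: m_prime.
by rewrite -[g]mul1r -ba -mulrA; apply: idealM.
Qed.

(* If [x] lies in [P] it raises the height too much; otherwise every element
   of [P] is in [span s + x P], so that [P = span s] by Nakayama. *)
Lemma bottom_of_chain t s P : (forall x, m x <-> span (s ++ t) x) ->
  is_prime P -> (forall g, g \in s -> P g) -> chain_to_max (size t) P ->
  forall x, P x <-> span s x.
Proof.
elim: t s P => [|x t IHt] s P mE hP sP; have [iP _ PM] := hP.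
  move=> /= mP y; split=> [/(prime_below_max hP)/mE|]; first by rewrite cats0.
  exact: span_min.
have mx : m x by apply/mE/span_elt; rewrite mem_cat mem_head orbT.
have mE' y : m y <-> span (rcons s x ++ t) y by rewrite cat_rcons.
have rP y : y \in rcons s x -> y = x \/ y \in s.
  by rewrite mem_rcons inE => /orP[/eqP->|]; [left | right].
move=> /[dup] cP /(chain_to_max_through mx hP)[Q [hQ PQ _ Qx cQ]].
have sQ : forall y, Q y <-> span (rcons s x) y.
  by apply: (IHt _ _ mE' hQ) => // y /rP[->|/sP/PQ].
have nPx : ~ P x.
  move=> Px; apply: (krull_height mE' hP) cP => y /rP[->//|]; exact: sP.
have [gs gsE] := nR iP.
have Ps : below P (span s).
  move=> y /gsE; apply: nakayama_local => // g ggs.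
  have Pg : P g by apply/gsE/span_elt.
  have /PQ/sQ Sg := Pg.
  have /span_cons[c [r [sc gE]]] : span (x :: s) g.
    by apply: span_subset Sg => z; rewrite mem_rcons.
  exists c, (r * x); split=> //; rewrite mulrC; apply: comb_mul => //; apply/gsE.
  have : P (r * x).
    by apply: (@idealDl P c) => //; [apply: span_min sc | rewrite -gE].
  by move=> /PM[].
by move=> y; split=> [/Ps|]; last apply: span_min.
Qed.

Lemma chain_to_max_above s n P : (forall g, g \in s -> m g) -> is_prime P ->
  chain_to_max (size s + n) P -> exists Q,
  [/\ is_prime Q, below P Q, forall g, g \in s -> Q g & chain_to_max n Q].
Proof.
elim: s P => [|x s IHs] P sm hP cP; first by exists P; split=> // g.
have mx : m x by apply: (sm x); rewrite mem_head.
have [Q [hQ PQ _ Qx cQ]] := chain_to_max_through mx hP cP.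
have [g gs|Q' [hQ' QQ' sQ' cQ']] := IHs Q _ hQ cQ.
  by apply: sm; rewrite inE gs orbT.
exists Q'; split=> // [y /PQ/QQ'//|g].
by rewrite inE => /orP[/eqP->|/sQ'//]; apply: QQ'.
Qed.

Section RegularParameters.
Context (d : nat) (P0 : R -> Prop) (P0_prime : is_prime P0).
Context (P0_chain : chain_to_max d P0).

Definition parameters s := size s = d /\ forall x, m x <-> span s x.

Lemma parameters_perm s t : perm_eq s t -> parameters s -> parameters t.
Proof.
move=> st [sz mE]; split; first by rewrite -(perm_size st).
move=> x; split=> [/mE|sx]; first by apply: span_subset => y; rewrite (perm_mem st).
by apply/mE; apply: span_subset sx => y; rewrite (perm_mem st).
Qed.

(** Forcing [s] into a chain of length [d] leaves a prime over [s] with a chain of length [size t],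
    which [bottom_of_chain] identifies with [span s]. *)
Lemma parameters_prime_span s t : parameters (s ++ t) ->
  is_prime (span s) /\ chain_to_max (size t) (span s).
Proof.
move=> [sz mE]; have [|||Q [hQ _ sQ cQ]] := @chain_to_max_above s (size t) P0.
- by move=> g gs; apply/mE/span_elt; rewrite mem_cat gs.
- exact: P0_prime.
- by rewrite -size_cat sz.
suff <- : Q = span s by [].
by apply/funext => x; apply/propext; apply: bottom_of_chain hQ sQ cQ x.
Qed.

Lemma parameters_prime_sequence s : parameters s -> prime_sequence s.
Proof.
move=> hs; split=> [s1 s2|s1 x s2]; rewrite perm_sym => /parameters_perm/(_ hs) h12.
  by case: (parameters_prime_span h12).
have [p1 c1] := parameters_prime_span h12; move=> s1x.
(* If [x] were in [span s1], then [s2] would generate [m] modulo [span s1], too few elements for the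
   chain [c1]. *)
apply: (@krull_height s2 (rcons s1 x) (span s1)) => //.
  by rewrite cat_rcons; case: h12.
by move=> g; rewrite mem_rcons inE => /orP[/eqP->//|]; apply: span_elt.
Qed.

(** Otherwise Nakayama would make [s] generate [m], with one element fewer than the length of the
    chain above [P0]. *)
Lemma parameters_minimal x s c e : parameters (x :: s) ->
  span s c -> comb m (x :: s) e -> x <> c + e.
Proof.
move=> [sz mE] sc se xE.
have ms y : m y -> span s y.
  move=> /mE; apply: nakayama_local => // g.
  rewrite inE => /orP[/eqP->|gs]; first by exists c, e.
  exists g, 0; split; [exact: span_elt | | by rewrite addr0].
  exact: ideal0 (comb_ideal (x :: s) m_ideal).
apply: (@krull_height s [::] P0) => //; last by rewrite (sz : (size s).+1 = d).
move=> y; split=> [/ms//|sy]; apply/mE.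
by apply: span_subset sy => z zs; rewrite inE zs orbT.
Qed.

(** Prepares the exchange: unless all coefficients of [x] on [t] are in [m], some [z] has a unit
    coefficient and can be traded for [x]. *)
Lemma span_cat_unit_or_max s t x : span (s ++ t) x ->
  (exists c e, [/\ span s c, comb m t e & x = c + e]) \/
  (exists t1 z t2 b r,
     [/\ t = t1 ++ z :: t2, ~ m b, span (s ++ t1 ++ t2) r & x = b * z + r]).
Proof.
elim: t x => [|z t IHt] x.
  by rewrite cats0 => sx; left; exists x, 0; rewrite addr0.
move=> stx; have : span (z :: s ++ t) x.
  by apply: span_subset stx => y; rewrite mem_cat !inE mem_cat orbCA.
move=> [b [y [_ sty ->]]]; have [mb|nmb] := pselect (m b); last first.
  by right; exists [::], z, t, b, y.
have [[c [e [sc te ->]]]|[t1 [z' [t2 [b' [r [-> nmb' str ->]]]]]]] := IHt y sty.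
  by left; exists c, (b * z + e); split; [|exists b, e|cring].
right; exists (z :: t1), z', t2, b', (b * z + r); split=> //; last by cring.
apply: idealD => //.
  by apply: idealM => //; apply: span_elt; rewrite mem_cat mem_head orbT.
by apply: span_subset str => y'; rewrite !mem_cat inE => /or3P[]->; rewrite ?orbT.
Qed.

(* Steinitz exchange modulo [m ^ 2]. *)
Lemma parameters_exchange s t (u z : seq R) : parameters (s ++ t) -> parameters (u ++ z) ->
  (forall g, g \in s -> span u g) ->
  exists u' : seq R, size (s ++ u') = size u /\ forall x, span (s ++ u') x <-> span u x.
Proof.
move=> hst huz; elim: s t hst => [|x s IHs] t hst su; first by exists u.
have hst' : parameters (s ++ x :: t).
  by apply: parameters_perm hst; apply/permPl/(perm_catCA [:: x] s t).
have [g gs|u' [sz uE]] := IHs _ hst'; first by apply: su; rewrite inE gs orbT.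
have mu g : g \in u -> m g.
  by case: huz => _ mE gu; apply/mE/span_elt; rewrite mem_cat gu.
have ux : span u x by apply: su; rewrite mem_head.
have /uE := ux.
(* In the first case [x] would be in [span s + m ^ 2], against [parameters_minimal]. *)
move=> /span_cat_unit_or_max[[c [e [sc ue xE]]]|[t1 [y [t2 [b [r [u'E nmb str xE]]]]]]].
  have cst : span (s ++ t) c.
    by apply: span_subset sc => g; rewrite mem_cat => ->.
  case: (@parameters_minimal x (s ++ t) c e) => //.
  apply: comb_min ue => [|a g ma gu']; first exact: comb_ideal.
  apply: comb_mul => //; case: hst => _ mE; apply/mE.
  have : span u g by apply/uE/span_elt; rewrite mem_cat gu' orbT.
  by apply: span_min.
(* The coefficient [b] of [y] is a unit, so [x] takes the place of [y]. *)
exists (t1 ++ t2); split.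
  by rewrite -sz u'E /= !size_cat /= !addnS.
have [b' b'b] := m_unit nmb.
have yE : y = b' * (x - r) by rewrite xE addrK mulrA b'b mul1r.
move=> w; split=> [|/uE].
  apply: span_min => // g; rewrite !(inE, mem_cat) => /predU1P[->//|gst].
  apply/uE/span_elt; rewrite u'E !(mem_cat, inE).
  by case/or3P: gst => ->; rewrite ?orbT.
rewrite u'E; apply: span_min => // g; rewrite !(mem_cat, inE).
have strx : span ((x :: s) ++ t1 ++ t2) r.
  by apply: span_subset str => g' g's; rewrite inE g's orbT.
case/or4P => [gs|gt1|/eqP->|gt2].
- by apply: span_elt; rewrite !(inE, mem_cat) gs ?orbT.
- by apply: span_elt; rewrite !(inE, mem_cat) gt1 ?orbT.
- rewrite yE; apply: idealM => //; apply: idealB => //.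
  by apply: span_elt; rewrite mem_head.
- by apply: span_elt; rewrite !(inE, mem_cat) gt2 ?orbT.
Qed.

End RegularParameters.
End Local.

(** * Powers of regular parameters *)

Lemma prime_sequence_catl s t : prime_sequence (s ++ t) -> prime_sequence s.
Proof.
move=> [Hp Hn]; split=> [s1 s2 h|s1 x s2 h].
  by apply: (Hp s1 (s2 ++ t)); rewrite catA perm_cat2r.
by apply: (Hn s1 x (s2 ++ t)); rewrite -cat_cons catA perm_cat2r.
Qed.

Lemma prime_sequence_perm s t : perm_eq s t -> prime_sequence s -> prime_sequence t.
Proof.
move=> /permPr st [Hp Hn].
by split=> [s1 s2|s1 x s2]; rewrite -st; [apply: Hp | apply: Hn].
Qed.

Lemma prime_sequence_behead x s : prime_sequence (x :: s) -> prime_sequence s.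
Proof.
move=> hs; apply: (@prime_sequence_catl s [:: x]).
by apply: prime_sequence_perm hs; rewrite cats1 perm_sym perm_rcons.
Qed.

Lemma prime_sequence_catr s t : prime_sequence (s ++ t) -> prime_sequence t.
Proof. by elim: s => //= x s IHs /prime_sequence_behead. Qed.

Lemma prime_sequence_span s : prime_sequence s -> is_prime (span s).
Proof. by case=> Hp _; apply: (Hp s [::]); rewrite cats0. Qed.

Lemma prime_sequence_notin x s : prime_sequence (x :: s) -> ~ span s x.
Proof. by case=> _ Hn; apply: (Hn s x [::]); rewrite cats1 perm_rcons. Qed.

Definition nonzerodiv A b := forall x, A (b * x) -> A x.

Lemma nonzerodiv_prime P b : is_prime P -> ~ P b -> nonzerodiv P b.
Proof. by move=> [_ _ PM] nPb x /PM[]. Qed.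

(** Since [v] is regular modulo [A], [A + (v)] modulo [A + (v * u)] is a copy of [R] modulo
    [A + (u)]; [b] is regular on it and on [R] modulo [A + (v)]. *)
Lemma nonzerodiv_mul A b u v : is_ideal A -> nonzerodiv A v ->
  nonzerodiv (add_elt A u) b -> nonzerodiv (add_elt A v) b ->
  nonzerodiv (add_elt A (v * u)) b.
Proof.
move=> hA nv nbu nbv x [a [r [Aa bxE]]].
have [|a' [x' [Aa' xE]]] := nbv x.
  by exists a, (r * u); split=> //; rewrite bxE; cring.
have [|a'' [x'' [Aa'' x'E]]] := nbu x'.
  exists (b * x' - r * u), r; split; last by cring.
  apply: nv; rewrite (_ : _ * _ = a - b * a').
    by apply: idealB => //; apply: idealM.
  rewrite (_ : a = b * x - r * (v * u)); last by rewrite bxE; cring.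
  by rewrite xE; cring.
exists (a' + v * a''), x''; split; last by rewrite xE x'E; cring.
by apply: idealD => //; apply: idealM.
Qed.

(* Pairs [(w, n)] stand for [w ^+ n.+1], which excludes the exponent 0. *)
Implicit Types (ps : seq (R * nat)).

Definition powers ps : seq R := [seq p.1 ^+ p.2.+1 | p <- ps].

Lemma powers_cat ps qs : powers (ps ++ qs) = powers ps ++ powers qs.
Proof. exact: map_cat. Qed.

Lemma span_cat_cons s t g x : span (s ++ g :: t) x <-> add_elt (span (s ++ t)) g x.
Proof.
rewrite -span_cons; split; apply: span_subset => y; rewrite !(mem_cat, inE);
  by case/or3P=> ->; rewrite ?orbT.
Qed.

(** For exponent one the base joins [s]; higher exponents follow by [nonzerodiv_mul], the base being
    regular modulo the other terms by induction. *)
Lemma nonzerodiv_powers ps s b : prime_sequence (s ++ unzip1 ps) ->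
  ~ span (s ++ unzip1 ps) b -> nonzerodiv (span (s ++ powers ps)) b.
Proof.
elim: ps s b => [|[w n] ps IHps] s b.
  by rewrite /= !cats0 => /prime_sequence_span; apply: nonzerodiv_prime.
move=> hs nsb.
have hw : prime_sequence (w :: s ++ unzip1 ps).
  by apply: prime_sequence_perm hs; apply/permPl/(perm_catCA s [:: w] (unzip1 ps)).
have spanE t y : span (s ++ w :: t) y <-> span (w :: s ++ t) y.
  by split; apply: span_subset => z; rewrite !(mem_cat, inE) orbCA.
have powE k y : span (s ++ powers ((w, k) :: ps)) y <->
    add_elt (span (s ++ powers ps)) (w ^+ k.+1) y by apply: span_cat_cons.
have n1 : nonzerodiv (add_elt (span (s ++ powers ps)) w) b.
  move=> x /span_cat_cons/spanE bx; apply/span_cat_cons/spanE.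
  by apply: (IHps (w :: s)) bx => // /spanE.
have nw : nonzerodiv (span (s ++ powers ps)) w.
  apply: IHps; last exact: prime_sequence_notin.
  exact: prime_sequence_behead hw.
move=> x /powE bx; apply/powE; move: x bx.
elim: n {hs nsb} => [|n IHn]; first by rewrite expr1.
by rewrite exprS; apply: nonzerodiv_mul.
Qed.

Lemma span_catP s t x : span (s ++ t) x -> exists a b, [/\ span s a, span t b & x = a + b].
Proof.
elim: s x => [|g s IHs] x /=; first by exists 0, x; rewrite add0r.
move=> [a [y [_ /IHs[b [c [sb tc ->]]] ->]]].
by exists (a * g + b), c; rewrite addrA; split=> //; exists a, b.
Qed.

(* [(ys) :&: J = (ys) J] when the [ys] form a regular sequence modulo [J]. *)
Lemma comb_powers_inter s ps x : prime_sequence (s ++ unzip1 ps) ->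
  span (powers ps) x -> span s x -> comb (span s) (powers ps) x.
Proof.
elim: ps x => [//|[w n] ps IHps] x hs [c [y [_ ys ->]]] sx.
have hw : prime_sequence (w :: s ++ unzip1 ps).
  by apply: prime_sequence_perm hs; apply/permPl/(perm_catCA s [:: w] (unzip1 ps)).
have hs' := prime_sequence_behead hw.
have nzw : nonzerodiv (span (s ++ powers ps)) (w ^+ n.+1).
  apply: nonzerodiv_powers => // /(primeX (prime_sequence_span hs')).
  exact: prime_sequence_notin.
(* The power of [w] is regular modulo [span s + (ys)], so [c] lies there; its part in [(ys)] is
   moved into the tail. *)
have [|c1 [c2 [sc1 sc2 cE]]] := @span_catP s (powers ps) c.
  apply: nzw; apply: (@idealDl _ y) => //.
    by apply: span_subset ys => z zs; rewrite mem_cat zs orbT.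
  rewrite addrC mulrC; apply: span_subset sx => z zs; rewrite mem_cat zs //.
exists c1, (c2 * w ^+ n.+1 + y); split=> //; last by rewrite cE /=; cring.
apply: IHps => //; first by apply: idealD => //; apply: idealMr.
apply: (@idealDl _ (c1 * w ^+ n.+1)) => //; first exact: idealMr.
have <- : c * w ^+ n.+1 + y = c1 * w ^+ n.+1 + (c2 * w ^+ n.+1 + y).
  by rewrite cE; cring.
exact: sx.
Qed.

(** This is the regularity of [a] on [J / (ys) J]. With [x = c * w ^+ n.+1 + x'], induction treats
    [x'], while [c] is treated modulo [J], where only the powers of [qs] survive. *)
Lemma comb_powers_nonzerodiv s ps qs a x :
  prime_sequence (unzip1 (ps ++ qs)) -> prime_sequence (s ++ unzip1 qs) ->
  (forall g, g \in unzip1 ps -> span s g) ->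
  ~ span (unzip1 (ps ++ qs)) a -> ~ span (s ++ unzip1 qs) a ->
  span s x -> comb (span s) (powers (ps ++ qs)) (a * x) ->
  comb (span s) (powers (ps ++ qs)) x.
Proof.
move=> + hsq; elim: ps x => [|[w n] ps IHps] x hps sps nspa nsqa sx /=.
  move=> /comb_span; move: hps nspa; rewrite -[unzip1 _]cat0s => hps nspa /=.
  move/(@nonzerodiv_powers qs [::] a hps nspa) => sqx.
  exact: comb_powers_inter.
have hps' := prime_sequence_behead hps.
have sps' g : g \in unzip1 ps -> span s g by move=> gps; apply: sps; rewrite inE gps orbT.
have nspa' : ~ span (unzip1 (ps ++ qs)) a.
  by move=> spa; apply: nspa; apply: span_subset spa => g gs; rewrite inE gs orbT.
have sw : span s (w ^+ n.+1).
  by rewrite exprS; apply: idealMr => //; apply: sps; rewrite mem_head.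
have nzw : nonzerodiv (span (powers (ps ++ qs))) (w ^+ n.+1).
  apply: (@nonzerodiv_powers _ [::]) => // /(primeX (prime_sequence_span hps')).
  exact: prime_sequence_notin.
have hsJ : is_ideal (comb (span s) (powers (ps ++ qs))) by apply: comb_ideal.
move=> [b [r [sb rJ axE]]].
have : span (powers ((w, n) :: ps ++ qs)) x.
  apply: (@nonzerodiv_powers ((w, n) :: ps ++ qs) [::] a) => //.
  rewrite axE; exists b, r; split=> //; exact: comb_span rJ.
move=> [c [x' [_ sx' xE]]].
(* Comparing both expressions of [a * x] gives [w ^+ n.+1 * h = r - a * x']. *)
pose h := a * c - b.
have sh : span (powers (ps ++ qs)) h.
  apply: nzw; rewrite (_ : _ * _ = r - a * x').
    by apply: idealB => //; [exact: comb_span rJ | apply: idealM].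
  rewrite (_ : r = a * x - b * w ^+ n.+1); last by rewrite axE /=; cring.
  by rewrite xE /h /=; cring.
have sx'J : span s x'.
  apply: (@idealDl _ (c * w ^+ n.+1)) => //; first exact: idealM.
  by rewrite -[X in span s X]xE.
have x'J : comb (span s) (powers (ps ++ qs)) x'.
  apply: IHps => //; rewrite (_ : _ * _ = r - w ^+ n.+1 * h).
    by apply: idealB => //; apply: comb_mul.
  rewrite (_ : r = a * x - b * w ^+ n.+1); last by rewrite axE /=; cring.
  by rewrite xE /h /=; cring.
(* [a * c = b + h] lies in [span s] plus the powers of [qs], as the bases of [ps] are in [span s];
   [a] is regular modulo that ideal. *)
have [c1 [c2 [sc1 sc2 cE]]] : exists a b, [/\ span s a, span (powers qs) b & c = a + b].
  apply: span_catP; apply: (nonzerodiv_powers hsq nsqa).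
  rewrite (_ : a * c = b + h); last by rewrite /h; cring.
  apply: idealD => //.
    by apply: span_subset sb => g gs; rewrite mem_cat gs.
  apply: span_min sh => // g; rewrite powers_cat mem_cat => /orP[/mapP[p pps ->]|gq].
    rewrite exprS; apply: idealMr => //.
    have : span s p.1 by apply: sps'; apply: map_f.
    by apply: span_subset => z zs; rewrite mem_cat zs.
  by apply: span_elt; rewrite mem_cat gq orbT.
rewrite xE; exists c1, (w ^+ n.+1 * c2 + x'); split=> //.
  apply: idealD => //; apply: comb_mul => //.
  by apply: span_subset sc2 => z zs; rewrite powers_cat mem_cat zs orbT.
by rewrite cE /=; cring.
Qed.

End Ideals.

(** * The subcomplexes killed by powers of parameters *)

Section Homology.
Context (R : comNzRingType).
Implicit Types (ys : seq R) (a b y : R).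

Section Annihilated.
Context (V : lmodType R).
Implicit Types (e f : V).

Definition killed ys e := forall y, y \in ys -> y *: e = 0.

Lemma killedP ys a e f : killed ys e -> killed ys f -> killed ys (a *: e + f).
Proof.
by move=> ke kf y yys; rewrite scalerDr scalerA mulrC -scalerA ke // kf // scaler0 addr0.
Qed.

Lemma killed0 ys : killed ys 0.
Proof. by move=> y _; rewrite scaler0. Qed.

Lemma killedZ ys a e : killed ys e -> killed ys (a *: e).
Proof. by move=> ke; rewrite -[_ *: _]addr0; apply: killedP => //; apply: killed0. Qed.

Lemma killedB ys e f : killed ys e -> killed ys f -> killed ys (e - f).
Proof. by move=> ke kf; rewrite addrC -scaleN1r; apply: killedP. Qed.

Lemma killed_cons y ys e : killed (y :: ys) e <-> y *: e = 0 /\ killed ys e.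
Proof.
split=> [ke|[ye ke] x]; last by rewrite inE => /orP[/eqP->|/ke].
by split=> [|x xys]; apply: ke; rewrite inE ?eqxx ?xys ?orbT.
Qed.

Lemma killed_span ys a e : killed ys e -> span ys a -> a *: e = 0.
Proof.
move=> ke; apply: (@span_min _ (fun a => a *: e = 0)) => //.
split=> [|k x y xe ye]; first by rewrite scale0r.
by rewrite scalerDl -scalerA xe ye scaler0 addr0.
Qed.

(** Sending [r * y + t] to [r *: e] is well defined on the ideal of [y :: ys], as [y] is regular
    modulo [ys] and [ys] kills [e]. An extension to [R], evaluated at 1, gives [f]. *)
Lemma injective_divisible ys y e : injective_module V ->
  nonzerodiv (span ys) y -> killed ys e -> exists f, killed ys f /\ y *: f = e.
Proof.
move=> injV nzy ke.
pose A : lmodType R := submod_of (pack_ideal (span_ideal (y :: ys))).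
have coef (x : A) : {r : R | exists t, span ys t /\ (val x : R) = r * y + t}.
  apply: cid; case: x => x /= xA; case: ((pack_idealE (span_ideal (y :: ys)) x).1 xA).
  by move=> r [t [_ st xE]]; exists r, t.
pose g (x : A) : V := sval (coef x) *: e.
have gE (x : A) r t : span ys t -> (val x : R) = r * y + t -> g x = r *: e.
  rewrite /g => st xE; case: (coef x) => r' [t' [st' xE']] /=.
  apply/eqP; rewrite -subr_eq0 -scalerBl; apply/eqP; apply: killed_span ke _.
  apply: nzy; suff -> : y * (r' - r) = t - t' by apply: idealB => //; apply: span_ideal.
  rewrite mulrC mulrBl; apply/eqP; rewrite subr_eq addrAC eq_sym subr_eq.
  by rewrite addrC -xE xE'.
have g_lin : linear g.
  move=> k x x'.
  case: (coef x) => r [t [st xE]]; case: (coef x') => r' [t' [st' xE']].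
  rewrite (gE _ _ _ st xE) (gE _ _ _ st' xE').
  rewrite (gE _ (k * r + r') (k * t + t')).
  - by rewrite scalerDl scalerA.
  - by apply: (span_ideal ys).2.
  - rewrite [val _](_ : _ = k * (val x : R) + (val x' : R)) // xE xE'.
    by rewrite mulrDr mulrDl mulrA !addrA; congr (_ + _); rewrite addrAC.
pose gL : {linear A -> V} := HB.pack g (GRing.isLinear.Build R A V _ g g_lin).
pose f : {linear A -> R^o} := [the {linear A -> R^o} of val].
have [h hE] := injV A R^o f gL val_inj.
have hval (r : R) : h (r : R^o) = r *: h 1.
  by rewrite -linearZ /= [_ *: _]mulr1.
exists (h 1); split=> [x xys|].
  have xyys : x \in y :: ys by rewrite inE xys orbT.
  have sx : (x : R^o) \in pack_ideal (span_ideal (y :: ys)).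
    exact: (pack_idealE (span_ideal (y :: ys)) x).2 (span_elt xyys).
  rewrite -hval -[x : R^o]/(f (Submod sx)) hE [gL _](@gE _ 0 x) ?scale0r //.
    exact: span_elt.
  by rewrite mul0r add0r.
have sy : (y : R^o) \in pack_ideal (span_ideal (y :: ys)).
  exact: (pack_idealE (span_ideal (y :: ys)) y).2 (span_elt (mem_head _ _)).
rewrite -hval -[y : R^o]/(f (Submod sy)) hE [gL _](@gE _ 1 0) ?scale1r //.
  exact: (span_ideal ys).1.
by rewrite mul1r addr0.
Qed.

End Annihilated.
End Homology.

(** * The cohomology step for one more annihilating element *)

Section KoszulStep.
Context (R : comNzRingType) (C : complex R).
Implicit Types (ys s : seq R) (a b y : R).

(** Cocycles and coboundaries of the subcomplex killed by [ys] are described inside [C], so that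
    [ys] can vary freely. *)
Definition cocycle ys i (z : C i) := killed ys z /\ cdiff C i z = 0.

Definition coboundary ys i : C i -> Prop :=
  match i with
  | 0%N => fun z => z = 0
  | j.+1 => fun z => exists w : C j, killed ys w /\ z = cdiff C j w
  end.

Lemma killed_cdiff ys i (w : C i) : killed ys w -> killed ys (cdiff C i w).
Proof. by move=> kw y /kw yw; rewrite -linearZ yw raddf0. Qed.

Lemma cocycle0 ys i : cocycle ys (0 : C i).
Proof. by split; [exact: killed0 | exact: raddf0]. Qed.

Lemma coboundary0 ys i : coboundary ys (0 : C i).
Proof. by case: i => //= i; exists 0; rewrite raddf0; split=> //; apply: killed0. Qed.

Lemma coboundaryP ys i a (z w : C i) :
  coboundary ys z -> coboundary ys w -> coboundary ys (a *: z + w).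
Proof.
case: i z w => [|i] z w /=; first by move=> -> ->; rewrite scaler0 addr0.
by move=> [u [ku ->]] [v [kv ->]]; exists (a *: u + v); rewrite linearP; split=> //; apply: killedP.
Qed.

Lemma coboundaryZ ys i a (z : C i) : coboundary ys z -> coboundary ys (a *: z).
Proof. by move=> bz; rewrite -[_ *: _]addr0; apply: coboundaryP => //; apply: coboundary0. Qed.

Lemma cocycle_cons y ys i (z : C i) : cocycle (y :: ys) z <-> y *: z = 0 /\ cocycle ys z.
Proof.
split=> [[/killed_cons[yz kz] dz]|[yz [kz dz]]] //.
by split=> //; apply/killed_cons.
Qed.

Context (s : seq R) (a : R).

(* [rep u z] says that the cocycle [z] represents the image of [u] under an
   isomorphism between [J / (ys) J], where [J = span s], and the [j]-th
   cohomology module of the subcomplex of [C] killed by [ys]. *)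
Record koszul_state ys j c (rep : R -> C j -> Prop) : Prop := {
  state_low : forall i b (z : C i), (i < j)%N -> span s b -> cocycle ys z ->
    coboundary ys (b ^+ c *: z);
  state_high : forall i (z : C i), (j < i)%N -> cocycle ys z -> coboundary ys z;
  state_nonzerodiv : forall i (z : C i), cocycle ys z -> coboundary ys (a *: z) ->
    coboundary ys z;
  rep_total : forall u, span s u -> exists z, rep u z;
  rep_linear : forall k u v z w, rep u z -> rep v w -> rep (k * u + v) (k *: z + w);
  rep_cocycle : forall u z, rep u z -> span s u /\ cocycle ys z;
  rep_coboundary : forall u z, rep u z ->
    coboundary ys z <-> comb (span s) ys u;
  rep_onto : forall z, cocycle ys z -> exists u, rep u z
}.

Lemma repZ ys j c (rep : R -> C j -> Prop) k u z :
  koszul_state ys c rep -> rep u z -> rep (k * u) (k *: z).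
Proof.
move=> st ruz; have := rep_linear st (k - 1) ruz ruz.
by rewrite mulrBl mul1r subrK scalerBl scale1r subrK.
Qed.

Lemma repB ys j c (rep : R -> C j -> Prop) u v z w :
  koszul_state ys c rep -> rep u z -> rep v w -> rep (u - v) (z - w).
Proof.
move=> st ruz rvw; have := rep_linear st (- 1) rvw ruz.
by rewrite mulN1r scaleN1r addrC [_ + z]addrC.
Qed.

Section Step.
Context (ys : seq R) (y : R).
Context (divy : forall i (e : C i), killed ys e -> exists f, killed ys f /\ y *: f = e).

(** The connecting map sends the class of [y *: w] to that of [cdiff C i w] and vanishes on
    multiples of [y]: subtracting cocycles from [w] makes it killed by [y] without changing its
    differential. *)
Lemma coboundary_lift i (w : C i) : killed ys w ->
  (exists v, cocycle ys v /\ coboundary ys (y *: w - y *: v)) ->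
  coboundary (y :: ys) (cdiff C i w : C i.+1).
Proof.
move=> kw [v [[kv dv]]]; rewrite -scalerBr => bwv.
suff [x [kx yx dx]] : exists x, [/\ killed ys x, y *: (w - v - x) = 0 & cdiff C i x = 0].
  exists (w - v - x); split.
    by apply/killed_cons; split=> //; apply: killedB => //; apply: killedB.
  by rewrite !raddfB /= dv dx !subr0.
case: i w v bwv kw kv dv => [|i] w v /= bwv kw kv dv.
  by exists 0; rewrite subr0 raddf0; split=> //; apply: killed0.
have [x [kx wvE]] := bwv; have [x' [kx' xE]] := divy kx.
exists (cdiff C i x'); split; [exact: killed_cdiff | | exact: cdiffK].
by rewrite scalerBr wvE -linearZ /= xE subrr.
Qed.

(** [y_low] makes [y] act as zero in cohomology below degree [j]; [y_top] bounds the kernel of [y]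
    on [J / (ys) J]; [a_top] is the regularity of [a] on the next top module. *)
Context (j c e : nat) (rep : R -> C j -> Prop) (st : koszul_state ys c rep).
Context (y_low : exists b r, span s b /\ y = r * b ^+ c).
Context (y_top : forall u b, span s u -> span s b -> comb (span s) ys (y * u) ->
  comb (span s) ys (b ^+ e * u)).
Context (a_top : forall u, span s u -> comb (span s) (y :: ys) (a * u) ->
  comb (span s) (y :: ys) u).

(** The new representation is the old one composed with the connecting map. *)
Definition next_rep u (z : C j.+1) :=
  exists w : C j, [/\ killed ys w, rep u (y *: w) & z = cdiff C j w].

Let combI (t : seq R) : is_ideal (comb (span s) t).
Proof. exact/comb_ideal/span_ideal. Qed.

(** Regularity of [a] on cohomology modulo [y]. Below [j] this is regularity on cohomology itself,
    above [j] everything vanishes, and in degree [j] it is [a_top]. *)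
Lemma step_mod_y i (w v : C i) : cocycle ys (y *: w) -> cocycle ys v ->
  coboundary ys (a *: (y *: w) - y *: v) ->
  exists v', cocycle ys v' /\ coboundary ys (y *: w - y *: v').
Proof.
move=> cw cv bwv; case: (ltngtP i j) => [ij|ji|ij].
- have ylow z : cocycle ys z -> coboundary ys (y *: z : C i).
    have [b [r [sb yE]]] := y_low => cz.
    by rewrite yE -scalerA; apply: coboundaryZ; apply: (state_low st).
  exists 0; split; first exact: cocycle0.
  rewrite scaler0 subr0; apply: (state_nonzerodiv st) => //.
  by have := coboundaryP 1 bwv (ylow v cv); rewrite scale1r subrK.
- exists 0; split; first exact: cocycle0.
  by rewrite scaler0 subr0; apply: (state_high st).
subst i; have [u ruw] := rep_onto st cw; have [u' ruv] := rep_onto st cv.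
have [su _] := rep_cocycle st ruw; have [su' _] := rep_cocycle st ruv.
have := repB st (repZ a st ruw) (repZ y st ruv).
move/(rep_coboundary st)/proj1/(_ bwv) => cuu'.
have [k [t [sk ct uE]]] : comb (span s) (y :: ys) u.
  apply: a_top => //; exists u', (a * u - y * u'); split=> //.
  by rewrite [u' * y]mulrC addrC subrK.
have [v' rkv] := rep_total st sk; exists v'; split; first by case: (rep_cocycle st rkv).
apply/(rep_coboundary st (repB st ruw (repZ y st rkv))).
by rewrite uE mulrC addrC addKr.
Qed.

(** The new cohomology is an extension of the kernel of [y] in degree [i] by the cokernel of [y] in
    degree [i - 1]. These are killed by [b ^+ (c + e)] and [b ^+ c], whence the exponent. *)
Lemma step_state : koszul_state (y :: ys) (c.*2 + e) next_rep.
Proof.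
split.
- move=> i b z ij sb /cocycle_cons[yz cz].
  have bz : coboundary ys (b ^+ (c + e) *: z).
    move: ij; rewrite ltnS leq_eqVlt => /predU1P[ij|ij]; last first.
      by rewrite addnC exprD -scalerA; apply: coboundaryZ; apply: (state_low st).
    subst i; rewrite exprD -scalerA; apply: coboundaryZ.
    have [u ruz] := rep_onto st cz; have [su _] := rep_cocycle st ruz.
    apply/(rep_coboundary st (repZ _ st ruz)); apply: y_top => //.
    by apply/(rep_coboundary st (repZ _ st ruz)); rewrite yz; apply: coboundary0.
  rewrite -addnn -addnA exprD -scalerA.
  case: i ij z yz cz bz => [|i] ij z yz cz /=; first by move=> ->; rewrite scaler0.
  move=> [w [kw zE]].
  (* [y *: w] is a cocycle in a degree below [j], so a further factor [b ^+ c] makes it a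
     coboundary. *)
  rewrite zE -linearZ; apply: coboundary_lift; first exact: killedZ.
  exists 0; split; first exact: cocycle0.
  rewrite scaler0 subr0 scalerA mulrC -scalerA; apply: (state_low st) => //.
  split; first exact: killedZ.
  by rewrite linearZ /= -zE scalerA mulrC -scalerA yz scaler0.
- move=> [|i] z // ji /cocycle_cons[yz cz].
  have [w [kw zE]] := state_high st (ltnW ji) cz.
  rewrite zE; apply: coboundary_lift => //; exists 0; split; first exact: cocycle0.
  rewrite scaler0 subr0; apply: (state_high st) => //.
  by split; [exact: killedZ | rewrite linearZ /= -zE].
- move=> [|i] z /cocycle_cons[yz cz].
    by move=> az; apply: (state_nonzerodiv st cz).
  move=> [w' [/killed_cons[yw' kw'] azE]].
  have [|w [kw zE]] := state_nonzerodiv st cz; first by exists w'.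
  rewrite zE; apply: coboundary_lift => //.
  (* [a *: w] and [w'] have the same differential, and [y] kills [w']. *)
  apply: (@step_mod_y i w (a *: w - w')).
  + by split; [exact: killedZ | rewrite linearZ /= -zE].
  + split; first by apply: killedB => //; apply: killedZ.
    by rewrite raddfB /= linearZ /= -zE -azE subrr.
  + rewrite scalerBr yw' subr0 !scalerA mulrC subrr; exact: coboundary0.
- move=> u su; have [z ruz] := rep_total st su.
  have [_ [kz dz]] := rep_cocycle st ruz; have [w [kw wE]] := divy kz.
  by exists (cdiff C j w), w; rewrite wE.
- move=> k u v _ _ [w [kw ruw ->]] [w' [kw' rvw' ->]].
  exists (k *: w + w'); split; [exact: killedP | | by rewrite linearP].
  by rewrite scalerDr scalerA [y * k]mulrC -scalerA; apply: (rep_linear st).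
- move=> u _ [w [kw ruw ->]]; have [su [_ dw]] := rep_cocycle st ruw.
  split=> //; split; last exact: cdiffK.
  by apply/killed_cons; split; [rewrite -linearZ | exact: killed_cdiff].
- move=> u _ [w [kw ruw ->]]; split=> [[w' [/killed_cons[yw' kw'] wE]]|].
    have cww' : cocycle ys (w - w').
      by split; [exact: killedB | rewrite raddfB /= wE subrr].
    have [k rk] := rep_onto st cww'; have [sk _] := rep_cocycle st rk.
    exists k, (u - y * k); split=> //; last by rewrite mulrC addrC subrK.
    apply/(rep_coboundary st (repB st ruw (repZ y st rk))).
    by rewrite scalerBr yw' subr0 subrr; apply: coboundary0.
  move=> [k [t [sk ct uE]]]; have [v rk] := rep_total st sk.
  apply: coboundary_lift => //; exists v; split; first by case: (rep_cocycle st rk).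
  apply/(rep_coboundary st (repB st ruw (repZ y st rk))).
  by rewrite uE mulrC addrC addKr.
- move=> z /cocycle_cons[yz cz].
  have [w [kw zE]] := state_high st (ltnSn j) cz.
  have cyw : cocycle ys (y *: w).
    by split; [exact: killedZ | rewrite linearZ /= -zE].
  have [u ruw] := rep_onto st cyw.
  by exists u, w.
Qed.

End Step.
End KoszulStep.

(** * Powers of all the parameters, added one at a time *)

Section KoszulOfPowers.
Context (R : comNzRingType) (C : complex R) (s : seq R) (a : R).
Context (C_inj : forall i, injective_module (C i)).
Context (rep0 : R -> C 0%N -> Prop) (st0 : koszul_state s a [::] 0 rep0).
Implicit Types (ps qs : seq (R * nat)) (ts : seq R).

Let spanI (ys : seq R) : is_ideal (span ys). Proof. exact: span_ideal. Qed.

Lemma power_nonzerodiv w n qs : prime_sequence (w :: unzip1 qs) ->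
  nonzerodiv (span (powers qs)) (w ^+ n.+1).
Proof.
move=> hw; have hq := prime_sequence_behead hw.
apply: (@nonzerodiv_powers _ qs [::]) => // /(primeX (prime_sequence_span hq)).
exact: prime_sequence_notin.
Qed.

Lemma span_catl_notin ts1 ts2 b : ~ span (ts1 ++ ts2) b -> ~ span ts2 b.
Proof.
by move=> nb tb; apply: nb; apply: span_subset tb => x xt; rewrite mem_cat xt orbT.
Qed.

(** Each new power is regular on [J / (ys) J], so [e = 0] is allowed and [c] stays 0: the lower
    cohomology vanishes. *)
Lemma koszul_transversal qs : prime_sequence (s ++ unzip1 qs) ->
  ~ span (s ++ unzip1 qs) a ->
  exists j (rep : R -> C j -> Prop), koszul_state s a (powers qs) 0 rep.
Proof.
elim: qs => [|[w n] qs IHqs] hs nsa; first by exists 0%N, rep0.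
have hw : prime_sequence (w :: s ++ unzip1 qs).
  by apply: prime_sequence_perm hs; apply/permPl/(perm_catCA s [:: w] (unzip1 qs)).
have hwq : prime_sequence (w :: unzip1 qs) by apply: prime_sequence_catr hs.
have hq := prime_sequence_behead hw.
have [|j [rep st]] := IHqs hq.
  move=> sa; apply: nsa; apply: span_subset sa => x; rewrite !(mem_cat, inE).
  by case/orP=> ->; rewrite ?orbT.
have nzw := power_nonzerodiv (n := n) hwq.
have div i (e : C i) : killed (powers qs) e ->
    exists f, killed (powers qs) f /\ w ^+ n.+1 *: f = e.
  by apply: injective_divisible.
exists j.+1; eexists; apply: (step_state (e := 0) div st).
(* For [c = 0] the factor [b ^+ c] is 1, so any [b] serves. *)
- by exists 0, (w ^+ n.+1); rewrite expr0 mulr1; split=> //; apply: ideal0.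
- move=> u b su sb cu; rewrite expr0 mul1r; apply: comb_powers_inter => //.
  exact: nzw (comb_span cu).
- move=> u su; apply: (@comb_powers_nonzerodiv _ s [::] ((w, n) :: qs)) => //.
  exact: span_catl_notin nsa.
Qed.

(* The exponent of each new element of [span s] is at least the current [c], so
   that its power annihilates the cohomology below the top degree. *)
Lemma koszul_powers n qs ts : (forall g, g \in ts -> span s g) ->
  prime_sequence (ts ++ unzip1 qs) -> prime_sequence (s ++ unzip1 qs) ->
  ~ span (ts ++ unzip1 qs) a -> ~ span (s ++ unzip1 qs) a ->
  exists ps, [/\ unzip1 ps = ts, forall p, p \in ps -> (n <= p.2)%N &
    exists j c (rep : R -> C j -> Prop),
      koszul_state s a (powers (ps ++ qs)) c rep].
Proof.
move=> + + hsq + nsa; elim: ts => [|w ts IHts] sts hts nta.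
  exists [::]; split=> //; have [j [rep st]] := koszul_transversal hsq nsa.
  by exists j, 0%N, rep.
have [||| ps [psE ps_n [j [c [rep st]]]]] := IHts.
- by move=> g gts; apply: sts; rewrite inE gts orbT.
- exact: prime_sequence_behead hts.
- exact: (@span_catl_notin [:: w]).
have psqE : unzip1 (ps ++ qs) = ts ++ unzip1 qs by rewrite -psE -map_cat.
pose N := maxn n c; exists ((w, N) :: ps); split.
- by rewrite /= psE.
- by move=> p; rewrite inE => /orP[/eqP->|/ps_n]; first exact: leq_maxl.
have sw : span s w by apply: sts; rewrite mem_head.
have nzw : nonzerodiv (span (powers (ps ++ qs))) (w ^+ N.+1).
  by apply: power_nonzerodiv; rewrite psqE.
have div i (e : C i) : killed (powers (ps ++ qs)) e ->
    exists f, killed (powers (ps ++ qs)) f /\ w ^+ N.+1 *: f = e.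
  by apply: injective_divisible.
exists j.+1, (c.*2 + 1)%N; eexists; apply: (step_state (e := 1) div st).
- exists w, (w ^+ (N.+1 - c)); split=> //.
  by rewrite -exprD subnK // leqW // leq_maxr.
(* From [y * u] in [(ys)] follows [u] in [(ys)], so [b * u] is in [(ys) J]; hence [e = 1]. *)
- move=> u b su sb /comb_span/nzw; rewrite expr1; exact: comb_mul.
- move=> u su; apply: (@comb_powers_nonzerodiv _ s ((w, N) :: ps)) => //.
  + by rewrite /= psqE.
  + by rewrite /= psE.
  + by rewrite /= psqE.
Qed.

End KoszulOfPowers.

(** * Torsion elements and powers of generators *)

Section TorsionElements.
Context (R : comNzRingType) (I : ideal R).

Lemma exp_ideal_pow x n k : x \in I -> (n <= k)%N -> x ^+ k \in ideal_pow I n.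
Proof.
move=> xI /subnK <-; rewrite exprD.
apply: (idealM _ (ideal_is_ideal (ideal_pow I n))).
elim: n => [|n IHn]; first by apply/asboolP => A; apply.
rewrite exprS; apply/asboolP => A; apply; apply/asboolP.
by exists x, (x ^+ n).
Qed.

Context (V : lmodType R) (ws : seq R) (Iws : forall x, x \in I -> span ws x).

Lemma ann_ideal (e : V) : is_ideal (fun x => x *: e = 0).
Proof.
split=> [|k x y xe ye]; first by rewrite scale0r.
by rewrite scalerDl -scalerA xe ye scaler0 addr0.
Qed.

Lemma sum_decr (f : R -> nat) w (ts : seq R) : w \in ts -> (0 < f w)%N ->
  (\sum_(x <- ts) (if x == w then (f x).-1 else f x) < \sum_(x <- ts) f x)%N.
Proof.
move=> wts fw.
have le t : (\sum_(x <- t) (if x == w then (f x).-1 else f x) <= \sum_(x <- t) f x)%N.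
  by apply: leq_sum => x _; case: ifP => // _; apply: leq_pred.
have [t1 [t2 ->]] : exists t1 t2, ts = t1 ++ w :: t2.
  by case/splitPr: wts => t1 t2; exists t1, t2.
rewrite !big_cat !big_cons /= eqxx -addnS leq_add // -addSn prednK //.
by rewrite leq_add2l.
Qed.

(** A pigeonhole argument: each factor in [I] is a combination of the [w], and replacing [e] by
    [w *: e] lowers the exponent of [w] by one. *)
Lemma ideal_pow_annihilates k (f : R -> nat) (e : V) :
  (forall w, w \in ws -> w ^+ f w *: e = 0) -> (\sum_(w <- ws) f w < k)%N ->
  forall x, x \in ideal_pow I k -> x *: e = 0.
Proof.
elim: k f e => // k IHk f e fe fk x /asboolP/(_ (pack_ideal (ann_ideal e))) xI.
apply/(pack_idealE (ann_ideal e))/xI => _ /asboolP[u [v [uI vI ->]]].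
apply/pack_idealE; apply: (span_min (colon_ideal v (ann_ideal e)) _ (Iws uI)).
move=> w wws; rewrite /colon mulrC -scalerA.
case: (posnP (f w)) => [f0|fw].
  by have := fe w wws; rewrite f0 expr0 scale1r => ->; rewrite !scaler0.
apply: (IHk _ (w *: e) _ (leq_trans (sum_decr wws fw) fk) v vI) => x' x'ws.
case: eqP => [->|_]; last by rewrite scalerA mulrC -scalerA fe // scaler0.
by rewrite scalerA -exprSr prednK // fe.
Qed.

Lemma killed_powers_torsion ps (e : V) : unzip1 ps =i ws -> killed (powers ps) e ->
  e \in torsion I V.
Proof.
move=> psws ke.
have [N NP] : exists N, forall p, p \in ps -> (p.2 < N)%N.
  elim: (ps) => [|p qs [N NP]]; first by exists 0%N.
  exists (maxn p.2.+1 N) => q; rewrite inE leq_max => /orP[/eqP->|/NP->].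
    by rewrite leqnn.
  by rewrite orbT.
apply/asboolP; exists (\sum_(w <- ws) N).+1.
apply: (@ideal_pow_annihilates _ (fun=> N)) => // w; rewrite -psws => /mapP[p pps ->].
rewrite -(subnK (NP p pps)) exprD -scalerA ke ?scaler0 //.
by apply/mapP; exists p.
Qed.

End TorsionElements.
Local Open Scope quotient_scope.

Lemma quotmod_pi0 (R : comNzRingType) (V : lmodType R) (S : submodClosed V) z :
  (\pi_(Quotient.quot (zmod_of S)) z : quotmod S) = 0 <-> z \in S.
Proof.
have pi0 : (\pi_(Quotient.quot (zmod_of S)) 0 : quotmod S) = 0 by exact: raddf0.
rewrite -pi0; split=> [/eqP|zS]; first by rewrite -Quotient.idealrBE subr0.
by apply/eqP; rewrite -Quotient.idealrBE subr0.
Qed.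

(** * Local cohomology of an ideal *)

Section LocalCohomologyOfIdeal.
Context (R : comNzRingType) (I J : ideal R) (s t : seq R).
Context (JE : forall x, x \in J <-> span s x) (IE : forall x, x \in I <-> span (s ++ t) x).
Context (st_prime : prime_sequence (s ++ t)).
Context (E : injective_resolution (submod_of J)).

Definition augmentation_rep (u : R) (z : E 0%N) :=
  exists v : submod_of J, (submod_val v : R) = u /\ z = res_aug E v.

(** With no annihilators imposed, the cohomology of the resolution is [J] in degree 0, which starts
    the induction. *)
Lemma augmentation_state a : nonzerodiv (span [::]) a ->
  koszul_state (C := E) s a [::] 0 augmentation_rep.
Proof.
move=> nza; have exS i (z : E i.+1) : cocycle [::] z -> coboundary [::] z.
  by move=> [_ /(res_exactS _).1[w ->]]; exists w.
have ex0 (z : E 0%N) : cocycle [::] z -> exists v, z = res_aug E v.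
  by move=> [_ /(res_exact0 _).1].
split.
- by [].
- by move=> [|i] z // _; apply: exS.
- move=> [|i] z cz; last by move=> _; apply: exS.
  have [v ->] := ex0 z cz; rewrite /= -linearZ => av0.
  have /(congr1 (@submod_val _ _ J)) : a *: v = 0.
    by apply: (@res_aug_inj _ _ E); rewrite av0 raddf0.
  move=> /nza v0; rewrite (_ : v = 0) ?raddf0 //; exact: val_inj.
- by move=> u /JE uJ; exists (res_aug E (Submod uJ)), (Submod uJ).
- move=> k _ _ _ _ [u [<- ->]] [v [<- ->]]; exists (k *: u + v).
  by rewrite linearP.
- move=> _ _ [u [<- ->]]; split; first by apply/JE/submod_valP.
  by split=> [y //|]; apply/res_exact0; exists u.
- move=> _ _ [u [<- ->]] /=; split=> [u0|u0].
    by rewrite (_ : u = 0) //; apply: (@res_aug_inj _ _ E); rewrite u0 raddf0.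
  by rewrite (_ : u = 0) ?raddf0 //; apply: val_inj.
- by move=> z /ex0[v ->]; exists (submod_val v), v.
Qed.

(** High powers of the generators kill both [z] and a primitive of [a *: z], so both live in one
    subcomplex; the primitive of [z] found there is again torsion. *)
Lemma torsion_complex_nonzerodiv a i (z : torsion_complex I E i) : a \notin I ->
  cdiff (torsion_complex I E) i z = 0 ->
  a *: z \in is_coboundary (C := torsion_complex I E) (i := i) ->
  z \in is_coboundary (C := torsion_complex I E) (i := i).
Proof.
move=> aI dz az.
have nsa : ~ span (s ++ t) a by move/IE; apply/negP.
have torE k (e : torsion_complex I E k) :
    exists n, forall x, x \in ideal_pow I n -> x *: submod_val e = 0.
  exact: asboolP _ (submod_valP e).
(* The empty span is zero, so [R] is a domain. *)
have nil_prime : is_prime (span (R := R) [::]).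
  by apply: prime_sequence_span; apply: (@prime_sequence_catl _ [::] (s ++ t)).
have nza : nonzerodiv (span [::]) a.
  apply: nonzerodiv_prime => // a0; apply: nsa.
  exact: (span_subset _ a0).
have st0 := augmentation_state nza.
have Einj i' : injective_module (E i') by apply: res_inj.
have powers_kill k ps (j : nat) (e : E j) : (forall x, x \in ideal_pow I k -> x *: e = 0) ->
    unzip1 ps = s ++ t -> (forall p, p \in ps -> (k <= p.2)%N) -> killed (powers ps) e.
  move=> ke psE psk _ /mapP[p pps ->]; apply: ke; apply: exp_ideal_pow.
    by apply/IE/span_elt; rewrite -psE; apply: map_f.
  exact/leqW/psk.
have tor ps (j : nat) (e : E j) : unzip1 ps = s ++ t -> killed (powers ps) e ->
    e \in torsion I (E j).
  move=> psE; apply: (@killed_powers_torsion _ _ _ (s ++ t)); last by rewrite psE.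
  by move=> x /IE.
have state k : exists ps, [/\ unzip1 ps = s ++ t, forall p, p \in ps -> (k <= p.2)%N &
    exists j c (rep : R -> E j -> Prop), koszul_state s a (powers ps) c rep].
  pose qs := [seq (x, k) | x <- t]; have qsE : unzip1 qs = t.
    by rewrite /unzip1 -map_comp map_id.
  have [|||||ps [psE psk st]] := koszul_powers Einj st0 k (qs := qs) (ts := s);
    rewrite ?qsE //; first exact: span_elt.
  exists (ps ++ qs); split=> //; first by rewrite /unzip1 map_cat; congr (_ ++ _).
  by move=> p; rewrite mem_cat => /orP[/psk//|/mapP[x _ ->]].
have [n nz] := torE i z.
have dz' : cdiff E i (submod_val z) = 0 by move/(congr1 (@submod_val _ _ _)): dz.
case: i z dz dz' az nz => [|i] z dz dz' az nz.
  have [ps [psE psn [j [c [rep st]]]]] := state n.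
  have kz := powers_kill n ps 0%N _ nz psE psn.
  move: az => /eqP/(congr1 (@submod_val _ _ _)) az.
  by apply/eqP/val_inj; apply: (state_nonzerodiv st (conj kz dz') az).
have [w aE] := asboolP _ az; have [k wk] := torE i w.
have [ps [psE psn [j [c [rep st]]]]] := state (maxn n k).
have kz : killed (powers ps) (submod_val z).
  by apply: (powers_kill n) => // p /psn; rewrite geq_max => /andP[].
have kw : killed (powers ps) (submod_val w).
  by apply: (powers_kill k) => // p /psn; rewrite geq_max => /andP[].
have [|w' [kw' zE]] := state_nonzerodiv st (conj kz dz').
  by exists (submod_val w); split=> //; move/(congr1 (@submod_val _ _ _)): aE.
by apply/asboolP; exists (Submod (tor _ _ _ psE kw')); apply: val_inj.
Qed.

Lemma local_cohomology_nonzerodiv a i (q : local_cohomology I E i) : a \notin I ->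
  a *: q = 0 -> q = 0.
Proof.
move=> aI; move: q; apply: quotmodW => z.
rewrite [_ *: _]quotmod_scale_pi => /quotmod_pi0 az; apply/quotmod_pi0.
by apply: (torsion_complex_nonzerodiv aI) az; apply/eqP/(submod_valP z).
Qed.

Lemma local_cohomology_torsion a i (q : local_cohomology I E i) : a \in I ->
  exists n, a ^+ n *: q = 0.
Proof.
move=> aI; move: q; apply: quotmodW => z.
have [n nz] := asboolP _ (submod_valP (submod_val z)).
exists n; rewrite [_ *: _]quotmod_scale_pi; apply/quotmod_pi0.
rewrite (_ : _ *: z = 0) ?rpred0 //.
by apply: val_inj; apply: val_inj; apply: nz; apply: exp_ideal_pow.
Qed.

(** Elements outside [I] are regular, so [p] is inside [I]; elements of [I] have a power in [p],
    hence are in [p]. *)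
Lemma Ass_local_cohomology i p : Ass (local_cohomology I E i) p -> p = (I : {pred R}).
Proof.
move=> [[[p0 p1 pid] pM] [q pE]].
have q0 : q <> 0 by move=> q0; move: p1; rewrite pE q0 inE scaler0 eqxx.
apply/funext => a; apply/idP/idP => [pa|aI].
  apply: contrapT => /negP aI; apply: q0; apply: (local_cohomology_nonzerodiv aI).
  by have := pE a; rewrite !inE [a \in p]pa => /esym/eqP.
have [n] := local_cohomology_torsion q aI.
move/eqP; have := pE (a ^+ n); rewrite inE => <-.
elim: n => [|n IHn]; first by rewrite expr0 (negPf p1).
by rewrite exprS => /pM/orP[|/IHn].
Qed.

End LocalCohomologyOfIdeal.

(** * Regular local rings and adapted systems of parameters *)

Section RegularLocalRings.
Context (R : comNzRingType) (m : ideal R) (d : nat).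
Context (R_regular : regular_local_ring m d).

Let nR : noeth R. Proof. by apply: noetherian_noeth; case: R_regular. Qed.

Lemma max_ideal_prime : is_prime (fun x => x \in m).
Proof.
have [_ [[m1 mmax] _] _ _] := R_regular.
have hm := ideal_is_ideal m; split=> //; first exact/negP.
move=> x y xym; have [|xm] := boolP (x \in m); [by left | right].
have hmx := add_elt_ideal x hm.
have [t [b [tm oneE]]] : add_elt (fun z => z \in m) x 1.
  apply: contrapT => n1; move/negP: xm; apply.
  apply: (mmax (pack_ideal hmx)).
  - by move=> z zm; apply/(pack_idealE hmx)/add_eltl.
  - by apply/negP => /(pack_idealE hmx).
  - exact/(pack_idealE hmx)/add_eltr.
rewrite -[y]mul1r oneE mulrDl; apply: (idealD hm); first exact: (idealMr _ hm).
by rewrite -mulrA; apply: (idealM _ hm).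
Qed.

(** A nonunit lies in some maximal ideal, supplied by [noeth_max], and locality identifies it with
    [m]. *)
Lemma notin_max_unit x : x \notin m -> exists y, y * x = 1.
Proof.
have [_ [_ muniq] _ _] := R_regular => xm; apply: contrapT => nunit.
have [|A [hA [n1 sA] Amax]] := @noeth_max R (fun A => ~ A 1 /\ below (span [:: x]) A) nR.
  exists (span [:: x]); split; [exact: span_ideal | split=> //].
  by move=> [b [_ [_ -> oneE]]]; apply: nunit; exists b; rewrite oneE addr0.
have Am : maximal_ideal (pack_ideal hA).
  split=> [|B AB B1 z zB]; first by apply/negP => /(pack_idealE hA).
  apply/(pack_idealE hA); apply: (Amax (fun z => z \in B)) => //.
  - exact: ideal_is_ideal.
  - by split=> [|w /sA Aw]; [exact/negP | apply: AB; apply/(pack_idealE hA)].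
  - by move=> w Aw; apply: AB; apply/(pack_idealE hA).
move/negP: xm; apply; rewrite -(muniq _ Am); apply/(pack_idealE hA)/sA/span_elt.
by rewrite mem_head.
Qed.

Lemma prime_idealP (p : {pred R}) : prime_ideal p -> is_prime (fun x => x \in p).
Proof.
move=> [[p0 p1 pid] pM]; split; last by move=> a b /pM/orP.
  by split=> // a x y xp yp; apply: pid.
exact/negP.
Qed.

(** The top of a prime chain of length [d] lies in [m] and can be replaced by it. *)
Lemma chain_to_max_exists :
  exists P, is_prime P /\ chain_to_max (fun x => x \in m) d P.
Proof.
have [_ _ [[p [pprime pinc]] _] _] := R_regular.
have m_prime := max_ideal_prime.
have pm k : (k <= d)%N -> below (fun x => x \in p k) (fun x => x \in m).
  move=> kd; apply: prime_below_max (prime_idealP (pprime k kd)) => x.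
  by move/negP/notin_max_unit.
case: d pprime pinc pm => [|n] pprime pinc pm; first by exists (fun x => x \in m); split=> // x.
suff chain k : (k <= n)%N ->
    chain_to_max (fun x => x \in m) k.+1 (fun x => x \in p (n - k)%N).
  exists (fun x => x \in p 0%N); split; first exact: prime_idealP (pprime _ _).
  by have := chain n (leqnn n); rewrite subnn.
elim: k => [|k IHk] kn.
  exists (fun x => x \in m); split=> //; rewrite subn0; first exact: pm.
  by move=> mp; apply: (pinc n _).2 => // x /(pm n.+1 (leqnn _)) /mp.
have [pp npp] := pinc (n - k.+1)%N (leq_ltn_trans (leq_subr _ _) (ltnSn n)).
rewrite subnSK // in pp npp.
exists (fun x => x \in p (n - k)%N); split=> //; last exact/IHk/ltnW.
exact/prime_idealP/pprime/leqW/leq_subr.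
Qed.

Lemma rsop_parameters r : regular_system_of_parameters m d r ->
  parameters (fun x => x \in m) d r.
Proof.
by move=> [_ sz mE]; split=> // x; rewrite mE; apply: ideal_spanE.
Qed.

Lemma extend_part_of_rsop (I J : ideal R) : {subset J <= I} ->
  gen_by_part_of_rsop m d I -> gen_by_part_of_rsop m d J ->
  exists s t, [/\ forall x, x \in J <-> span s x, forall x, x \in I <-> span (s ++ t) x &
    prime_sequence (s ++ t)].
Proof.
move=> JI [u [z [/rsop_parameters uz IE]]] [s [t [/rsop_parameters st JE]]].
have [P0 [P0_prime P0_chain]] := chain_to_max_exists.
have JE' x : x \in J <-> span s x by rewrite JE; apply: ideal_spanE.
have IE' x : x \in I <-> span u x by rewrite IE; apply: ideal_spanE.
have m_unit x : ~ x \in m -> exists y, y * x = 1 by move/negP/notin_max_unit.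
have [|u' [sz uE]] := parameters_exchange nR max_ideal_prime m_unit P0_prime P0_chain st uz.
  by move=> g gs; apply/IE'/JI/JE'/span_elt.
have IE'' x : x \in I <-> span (s ++ u') x.
  by split=> [/IE'/uE|/uE/IE'].
(* [s ++ u'] has the size and the span of [u], so [z] completes it to a system of parameters. *)
exists s, u'; split=> //; apply: (@prime_sequence_catl _ _ z).
apply: (parameters_prime_sequence nR max_ideal_prime m_unit P0_prime P0_chain).
have [uz_sz mE] := uz; split; first by rewrite size_cat sz -size_cat.
move=> x; split=> [/mE|].
  apply: span_min => [|g]; first exact: span_ideal.
  rewrite mem_cat => /orP[gu|gz].
    have /uE : span u g by apply: span_elt.
    by apply: span_subset => y yu; rewrite mem_cat yu.
  by apply: span_elt; rewrite mem_cat gz orbT.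
apply: (span_min (ideal_is_ideal m)) => g.
rewrite mem_cat => /orP[gsu|gz]; apply/mE.
  have /uE : span (s ++ u') g by apply: span_elt.
  by apply: span_subset => y yu; rewrite mem_cat yu.
by apply: span_elt; rewrite mem_cat gz orbT.
Qed.

End RegularLocalRings.

Theorem proposition5p5 (R : comNzRingType) (m : ideal R) (d : nat)
    (R_regular : regular_local_ring m d) (dim_le6 : (d <= 6)%N)
    (R_LCfinite : LC_finite R)
    (I J : ideal R) (J_sub_I : {subset J <= I})
    (I_gen : gen_by_part_of_rsop m d I)
    (J_gen : gen_by_part_of_rsop m d J) (i : nat) :
  finite_Ass_lc I i (submod_of J).
Proof.
move=> E; have [s [t [JE IE st_prime]]] := extend_part_of_rsop R_regular J_sub_I I_gen J_gen.
apply: (@sub_finite_set _ _ [set (I : {pred R})]%classic); last exact: finite_set1.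
by move=> p /(Ass_local_cohomology JE IE st_prime) ->.
Qed.
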